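(* Let $\{Z_t\}_{t\ge0}$ be a Gaussian process satisfying the scaling condition uniformly over $(0,T)$ with exponent $\gamma\in[1,2)$ and functions $L$ and $C_\gamma^{(Z)}$. Let $f\in C^2(\mathbb R)$ and assume that for each fixed $\tau\in(0,T)$: (a) $\mathbb E[(Z_{\tau+r}-Z_\tau)Z_\tau]=O(|r|)$ and $\mathbb E[Z_{\tau+r}]-\mathbb E[Z_\tau]=O(|r|)$, as $r\to0$; (b) $\mathbb E[(f'(Z_\tau))^4]<\infty$, and $\mathbb E[\sup_{t\in(\tau-\epsilon,\tau+\epsilon)}(f''(Z_t))^4]<\infty$ for some $\epsilon>0$. Then the process $V_t:=f(Z_t)$, $t\ge0$, satisfies the scaling condition with the same exponent $\gamma$: for each $\tau\in(0,T)$, $$\mathbb E[(V_{\tau+r}-V_\tau)(V_{\tau+s}-V_\tau)]=\mathbb E[(f'(Z_\tau))^2]\,L(\tau)\,C_\gamma^{(Z)}(r,s)+o\big((r^2+s^2)^{\gamma/2}\big),\qquad r,s\to0.$$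
   Context: Scaling condition uniformly over $(0,T)$ for $Z$ with exponent $\gamma$ and functions $L\ge0$, $C^{(Z)}_\gamma:\mathbb R\times\mathbb R\to\mathbb R$: $C^{(Z)}_\gamma$ is not identically zero, $C_\gamma^{(Z)}(hr,hs)=h^\gamma C_\gamma^{(Z)}(r,s)$ for all $r,s\in\mathbb R$, $h>0$; $\sup_{\tau\in(0,T)}(r^2+s^2)^{-\gamma/2}\big|\mathbb E[(Z_{\tau+r}-Z_\tau)(Z_{\tau+s}-Z_\tau)]-L(\tau)C_\gamma^{(Z)}(r,s)\big|\to0$ as $r,s\to0$ (over $\tau,r,s$ with $\tau+r,\tau+s\ge0$); and $\sup_{\tau\in(0,T)}|L(\tau)|<\infty$. (This implies $\mathbb E[(Z_t-Z_s)^2]\le C|t-s|^\gamma$ for $t,s\in(0,T)$ and some constant $C$, so that $Z$ has a continuous modification on $[0,T]$, which is the version considered.) *)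

(* Defs.v *)
From HB Require Import structures.
From mathcomp Require Import all_boot all_order all_algebra.
From mathcomp Require Import all_classical all_reals all_analysis.

Set Implicit Arguments.
Unset Strict Implicit.
Unset Printing Implicit Defensive.

Import Order.TTheory GRing.Theory Num.Theory.
Import numFieldNormedType.Exports.

Local Open Scope classical_set_scope.
Local Open Scope ring_scope.

(* A process indexed by [0, +oo[ is represented by a family indexed by R whose
   values at negative times are irrelevant: only nonnegative times enter the
   conditions below (near 0, r and s satisfy tau + r, tau + s >= 0 if tau > 0). *)

(* [normal_prob m s] is not meant for s = 0, hence the separate Dirac case:
   constants are (degenerate) Gaussian random variables. *)
Definition gaussian_rv d (Omega : measurableType d) (R : realType)
    (P : probability Omega R) (X : Omega -> R) : Prop :=
  exists m s : R, forall A : set R, measurable A ->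
    P (X @^-1` A) = if s == 0 then dirac m A else normal_prob m s A.

Definition gaussian_process d (Omega : measurableType d) (R : realType)
    (P : probability Omega R) (Z : R -> {RV P >-> R}) : Prop :=
  forall (n : nat) (a t : 'I_n -> R), (forall i, 0 <= t i) ->
    gaussian_rv P (fun w => \sum_(i < n) a i * Z (t i) w).

Definition increment_moment d (Omega : measurableType d) (R : realType)
    (P : probability Omega R) (X : R -> Omega -> R) (tau r s : R) : \bar R :=
  'E_P[fun w => (X (tau + r) w - X tau w) * (X (tau + s) w - X tau w)].

Definition uniform_scaling d (Omega : measurableType d) (R : realType)
    (P : probability Omega R) (X : R -> Omega -> R)
    (T gamma : R) (L : R -> R) (C : R -> R -> R) : Prop :=
  [/\ forall tau, tau \in `]0, T[ -> 0 <= L tau,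
      exists r s, C r s != 0,
      forall r s h, 0 < h -> C (h * r) (h * s) = h `^ gamma * C r s,
      ereal_sup
        [set (((rs.1 ^+ 2 + rs.2 ^+ 2) `^ (- (gamma / 2)))%:E *
              `| increment_moment P X tau rs.1 rs.2
                 - (L tau * C rs.1 rs.2)%:E |)%E
          | tau in [set tau | [/\ tau \in `]0, T[, 0 <= tau + rs.1
                                & 0 <= tau + rs.2]]]
        @[rs --> ((0, 0) : R * R)^'] --> 0%E
    & (ereal_sup [set `|L tau|%:E | tau in [set` `]0%R, T[]] < +oo)%E].

(* The expansion is an equality in \bar R with a real-valued remainder, so it
   also says that the expectation on the left is finite for small r and s. *)
Definition scaling_at d (Omega : measurableType d) (R : realType)
    (P : probability Omega R) (X : R -> Omega -> R)
    (tau gamma : R) (K : \bar R) (C : R -> R -> R) : Prop :=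
  exists2 rho : R * R -> R,
    rho =o_ (nbhs ((0, 0) : R * R))
      (fun rs : R * R => (rs.1 ^+ 2 + rs.2 ^+ 2) `^ (gamma / 2)) &
    \forall rs \near ((0, 0) : R * R),
      increment_moment P X tau rs.1 rs.2
      = (K * (C rs.1 rs.2)%:E + (rho rs)%:E)%E.

Definition expectation_bigO (R : realType) (g : R -> \bar R) : Prop :=
  exists2 rho : R -> R, rho =O_ (nbhs (0 : R)) (fun r : R => `|r|) &
    \forall r \near (0 : R), g r = (rho r)%:E.

Definition class_C2 (R : realType) (f : R -> R) : Prop :=
  [/\ forall x, derivable f x 1,
      forall x, derivable (derive1 f) x 1
    & continuous (derive1n 2 f)].

(* Main.v *)
Require Import Defs.
From HB Require Import structures.
From mathcomp Require Import all_boot all_order all_algebra.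
From mathcomp Require Import all_classical all_reals all_analysis.
From mathcomp Require Import measurable_realfun ring lra.
Import Order.TTheory GRing.Theory Num.Theory.
Import numFieldNormedType.Exports.
Local Open Scope classical_set_scope.
Local Open Scope ring_scope.

(* Write X_r = Z_(tau+r) - Z_tau, Y = Z_tau, q = r^2 + s^2. A second-order
   Taylor expansion gives f(Z_(tau+r)) - f(Z_tau) = f'(Y) X_r + Q_r X_r^2 with
   Q_r bounded in L^4, so that the terms containing some Q contribute
   O(q^(3 gamma/4)). It remains to compare E[f'(Y)^2 X_r X_s] with
   E[f'(Y)^2] E[X_r X_s]. By polarization one replaces X_r X_s by U^2 with
   U = X_r + X_s or X_r - X_s. By assumption (a), U is the sum of an affine
   function of Y with coefficients O(q^(1/2)) and of a centered Gaussian W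
   uncorrelated with Y, whence an error O(q^(1/2 + gamma/4)) = o(q^(gamma/2)).

   That E[g(Y) W^2] = E[g(Y)] E[W^2] is proved without characteristic
   functions: for phi(y) = max(y - x, 0)^2, the law of Y + b W is known to be
   N(E Y, Var Y + b^2 Var W), so E[phi(Y + b W)] can be expanded at b = 0 both
   by dominated convergence and by Stein's identity; comparing the coefficients
   of b^2 gives the claim for g the indicator of ]x, +oo[, and these half-lines
   generate the Borel sets. *)

Set Implicit Arguments.
Unset Strict Implicit.
Unset Printing Implicit Defensive.

(** * Weighted image measures *)

(** Wick's formula for E[f'(Y)^2 X_r X_s] would differentiate f'^2 twice and so require a third
    derivative of f. Hence the Gaussian structure has to act on the increments alone, and f'(Y)^2 is
    treated as an arbitrary nonnegative function of Y with a second moment. Joint normality is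
    available only as the normality of each linear combination; this suggests testing with functions
    of Y + b W. The function phi has second derivative 2 on ]x, +oo[ and 0 below x, so a symmetric
    second difference in b isolates the half-line. Both bounds on gamma enter when exponents are
    compared, for q at most 1. The increments have size q^(gamma/4), and the errors are of order
    q^(1/2 + gamma/4), q and q^(3 gamma/4). The first is o(q^(gamma/2)) because gamma < 2; the last
    is dominated by the first because gamma is at least 1. The variance of Y may vanish, in which
    case there is no regression on Y; this case is treated apart. All constants must be independent
    of r and s, so the estimates are stated for arbitrary U, X1, X2 with a constant chosen
    beforehand. *)

Ltac mfun := repeat first [ done | assumption
  | exact: measurable_cst | exact: measurable_id | exact: measurable_normal_pdf
  | exact: measurable_indic | apply: measurable_funM | apply: measurable_funB
  | apply: measurable_funD | apply: measurable_funN | apply: measurable_funX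
  | apply: measurable_maxr | apply: measurableT_comp ].

(** The image under [Y] of the measure with density [p]. With [p] equal to W^2, it encodes
    E[g(Y) W^2] for all g at once. *)
Definition weighted_law d (T : measurableType d) (R : realType)
    (mu : {measure set T -> \bar R}) (Y p : T -> R) : set R -> \bar R :=
  fun A => (\int[mu]_(x in Y @^-1` A) (p x)%:E)%E.

Section weighted_law.
Context d (T : measurableType d) (R : realType).
Context (mu : {measure set T -> \bar R}) (Y p : T -> R).
Hypothesis mY : measurable_fun setT Y.
Hypothesis mp : measurable_fun setT p.
Hypothesis p_ge0 : forall x, 0 <= p x.
Local Open Scope ereal_scope.

Lemma measurable_preimage A : measurable A -> measurable (Y @^-1` A).
Proof. by move=> mA; rewrite -[X in measurable X]setTI; exact: mY. Qed.

Lemma weighted_law0 : weighted_law mu Y p set0 = 0.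
Proof. by rewrite /weighted_law preimage_set0 integral_set0. Qed.

Lemma weighted_law_ge0 A : 0 <= weighted_law mu Y p A.
Proof. by apply: integral_ge0 => x _; rewrite lee_fin. Qed.

Lemma weighted_law_sigma_additive : semi_sigma_additive (weighted_law mu Y p).
Proof.
move=> /= F mF tF mUF; rewrite /weighted_law preimage_bigcup.
rewrite ge0_integral_bigcup//=.
- by apply: is_cvg_ereal_nneg_natsum_cond => n _ _; exact: weighted_law_ge0.
- by move=> n; exact: measurable_preimage.
- exact/measurable_EFinP/measurable_funTS.
- by move=> x _; rewrite lee_fin.
- by move=> i j _ _ [x [Fi Fj]]; apply: (tF i j) => //; exists (Y x).
Qed.

Import HBNNSimple.

Let nnsfunE (g : {nnsfun R >-> R}) :
  \int[mu]_x ((g (Y x))%:E * (p x)%:E) =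
  \sum_(y \in range g) y%:E * weighted_law mu Y p (g @^-1` [set y]).
Proof.
have m1 y : measurable_fun setT (fun x => (y * \1_(g @^-1` [set y]) (Y x))%:E).
  by apply/measurable_EFinP; apply: measurable_funM => //;
    exact: measurableT_comp.
transitivity (\int[mu]_x \sum_(y \in range g)
    ((y * \1_(g @^-1` [set y]) (Y x))%:E * (p x)%:E)).
  apply: eq_integral => x _.
  rewrite -ge0_mule_fsuml => [|y]; last exact: nnfun_muleindic_ge0.
  by rewrite fsumEFin // -(fimfunE _ (Y x)).
rewrite ge0_integral_fsum//; last 2 first.
  - by move=> y; apply: emeasurable_funM => //; exact/measurable_EFinP.
  - move=> y x _; apply: mule_ge0; last by rewrite lee_fin.
    exact: nnfun_muleindic_ge0.
apply: eq_fsbigr => y; rewrite inE => -[t _ <-{y}].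
under eq_integral do rewrite EFinM -muleA.
rewrite ge0_integralZl ?lee_fin//; last 2 first.
  - apply: emeasurable_funM; apply/measurable_EFinP => //.
    exact: measurableT_comp.
  - by move=> x _; rewrite mule_ge0 ?lee_fin.
congr (_ * _); rewrite /weighted_law [RHS]integral_mkcond.
by apply: eq_integral => x _; rewrite epatch_indic muleC.
Qed.

Let approx (f : R -> R) (mf : measurable_fun setT f) :=
  nnsfun_approx (@measurableT _ R) ((measurable_EFinP setT f).2 mf).

(** The right-hand side depends on [mu], [Y] and [p] only through the weighted law, so equality of
    weighted laws yields equality of integrals by mere rewriting. *)
Lemma nnsfun_approx_integral (f : R -> R) (mf : measurable_fun setT f) :
  (forall x, 0 <= f x)%R ->
  \int[mu]_x ((f (Y x))%:E * (p x)%:E) =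
  limn (fun n => \sum_(y \in range (approx mf n))
     y%:E * weighted_law mu Y p (approx mf n @^-1` [set y])).
Proof.
move=> f0; transitivity (limn (fun n =>
    \int[mu]_x ((approx mf n (Y x))%:E * (p x)%:E))); last first.
  by congr (limn _); apply/funext => n; rewrite nnsfunE.
rewrite -monotone_convergence//.
- apply: eq_integral => x _; apply/esym/cvg_lim => //.
  by apply: cvgeZr => //; apply: cvg_nnsfun_approx => // y _; rewrite lee_fin.
- move=> n; apply: emeasurable_funM; apply/measurable_EFinP => //.
  exact: measurableT_comp.
- by move=> n x _; rewrite mule_ge0 ?lee_fin.
- move=> x _ m n mn; rewrite lee_wpmul2r ?lee_fin//.
  exact/lefP/nd_nnsfun_approx.
Qed.

End weighted_law.

Section transfer.
Context d1 d2 (T1 : measurableType d1) (T2 : measurableType d2) (R : realType).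
Context (mu1 : {measure set T1 -> \bar R}) (mu2 : {measure set T2 -> \bar R}).
Context (Y1 : T1 -> R) (Y2 : T2 -> R) (p1 : T1 -> R) (p2 : T2 -> R).
Hypothesis mY1 : measurable_fun setT Y1.
Hypothesis mY2 : measurable_fun setT Y2.
Hypothesis mp1 : measurable_fun setT p1.
Hypothesis mp2 : measurable_fun setT p2.
Hypothesis p1_ge0 : forall x, 0 <= p1 x.
Hypothesis p2_ge0 : forall x, 0 <= p2 x.
Local Open Scope ereal_scope.
Import HBNNSimple.

(** The two spaces may differ: this serves to pass from [P] to the standard normal law, and also to
    compare two weights under [P] itself. *)
Lemma integral_transfer (f : R -> R) :
  (forall A : set R, measurable A ->
    weighted_law mu1 Y1 p1 A = weighted_law mu2 Y2 p2 A) ->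
  measurable_fun setT f -> (forall x, 0 <= f x)%R ->
  \int[mu1]_x (f (Y1 x) * p1 x)%:E = \int[mu2]_x (f (Y2 x) * p2 x)%:E.
Proof.
move=> p12 mf f0.
under eq_integral do rewrite EFinM.
under [RHS]eq_integral do rewrite EFinM.
rewrite !(nnsfun_approx_integral _ _ _ _ mf)//.
congr (limn _); apply/funext => n; apply: eq_fsbigr => y _.
by rewrite p12.
Qed.

Let w1 : set R -> \bar R := weighted_law mu1 Y1 p1.
Let w2 : set R -> \bar R := weighted_law mu2 Y2 p2.

HB.instance Definition _ := isMeasure.Build _ _ _ w1
  (weighted_law0 _ _ _) (weighted_law_ge0 mu1 Y1 p1_ge0)
  (weighted_law_sigma_additive mY1 mp1 p1_ge0).
HB.instance Definition _ := isMeasure.Build _ _ _ w2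
  (weighted_law0 _ _ _) (weighted_law_ge0 mu2 Y2 p2_ge0)
  (weighted_law_sigma_additive mY2 mp2 p2_ge0).

Lemma weighted_law_unique : (\int[mu1]_x (p1 x)%:E < +oo) ->
  (forall x : R, weighted_law mu1 Y1 p1 `]x, +oo[ =
    weighted_law mu2 Y2 p2 `]x, +oo[) ->
  forall A : set R, measurable A ->
    weighted_law mu1 Y1 p1 A = weighted_law mu2 Y2 p2 A.
Proof.
move=> foo w12 A mA.
rewrite -/w1 -/w2.
(* Open right half-lines are stable under intersection, and those starting at -n cover the line;
   each has finite mass because the total mass of [p1] is finite. *)
apply: (@measure_unique _ R R (@RGenOInfty.G R)
  (fun n => `](- n%:R)%R, +oo[%classic)) => //.
- exact: RGenOInfty.measurableE.
- move=> B D [x ->] [y ->]; exists (Num.max x y).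
  apply/seteqP; split => z /=; rewrite !in_itv/= !andbT gt_max.
    by move=> [-> ->].
  by move=> /andP.
- by move=> i; exists (- i%:R)%R.
- apply/seteqP; split => // x _.
  exists (Num.trunc `|x|).+1 => //=; rewrite in_itv/= andbT ltrNl.
  rewrite (le_lt_trans (ler_norm _))// normrN.
  by rewrite -truncn_le_nat.
- by move=> B [x ->]; exact: w12.
- move=> k; apply: le_lt_trans foo.
  rewrite /w1 /weighted_law; apply: ge0_subset_integral => //.
  - exact: measurable_preimage.
  - exact/measurable_EFinP.
  - by move=> x _; rewrite lee_fin.
Qed.

End transfer.

(** * The standard normal law *)

Section std_normal_pdf.
Context {R : realType}.
Implicit Types (a b c x z : R).

Definition std_pdf : R -> R := normal_pdf 0 1.
Local Notation c0 := (normal_peak (1 : R)).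
Local Notation mu := (@lebesgue_measure R).

Lemma std_pdfE z : std_pdf z = c0 * expR (- (z ^+ 2 / 2)).
Proof.
by rewrite /std_pdf normal_pdfE ?oner_neq0// /normal_fun subr0 expr1n mulNr.
Qed.

Lemma std_pdf_ge0 z : 0 <= std_pdf z. Proof. exact: normal_pdf_ge0. Qed.

Lemma continuous_std_pdf : continuous std_pdf.
Proof. exact/continuous_normal_pdf/oner_neq0. Qed.

Lemma is_derive_std_pdf z : is_derive z 1 std_pdf (- z * std_pdf z).
Proof.
have -> : std_pdf = (fun z => c0 * expR (- (z ^+ 2 / 2))).
  by apply/funext => x; exact: std_pdfE.
have h : is_derive z 1 (fun x : R => - (x ^+ 2 / 2)) (- z).
  have H := is_deriveN (is_deriveM (is_deriveX 2 (is_derive_id z (1:R)))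
    (is_derive_cst (2^-1 : R) z (1:R))).
  apply: (is_derive_eq H).
  by rewrite scaler0 add0r /= /GRing.scale/= expr1 mulr1; lra.
have H := is_deriveM (is_derive_cst c0 z (1:R)) 
  (@is_derive1_comp R expR (fun x => - (x ^+ 2 / 2)) z _ _ (is_derive_expR _) h).
apply: (is_derive_eq H).
by rewrite scaler0 addr0 /cst /GRing.scale/=; ring.
Qed.

(** One primitive for three uses: (b, c) = (0, 1) gives the mean, (1, 0) the variance and (1, -a)
    Stein's identity for the positive part of z - a. *)
Lemma is_derive_affine_std_pdf b c z :
  is_derive z 1 (fun x => - ((b * x + c) * std_pdf x))
    (((b * z + c) * z - b) * std_pdf z).
Proof.
have h : is_derive z 1 (fun x : R => b * x + c) b.
  have H := is_deriveD (is_deriveM (is_derive_cst b z (1:R)) (is_derive_id z (1:R)))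
    (is_derive_cst c z (1:R)).
  apply: (is_derive_eq H).
  by rewrite scaler0 !addr0 /cst /GRing.scale/= mulr1.
have H := is_deriveN (is_deriveM h (is_derive_std_pdf z)).
by apply: (is_derive_eq H); rewrite /GRing.scale/=; ring.
Qed.

(** From exp(z^2/2) >= z^2/2 the density is at most 2 c0 / z^2. The resulting decay in 1/|z|
    suffices for the boundary terms at both infinities. *)
Lemma affine_std_pdf_bound b c z : 1 <= `|z| ->
  `|(b * z + c) * std_pdf z| <= (2 * c0 * (`|b| + `|c|)) * `|z|^-1.
Proof.
move=> z1; have z0 : 0 < `|z| by exact: lt_le_trans z1.
have c00 : 0 <= c0 by exact: normal_peak_ge0.
rewrite normrM (ger0_norm (std_pdf_ge0 z)).
have h1 : `|b * z + c| <= (`|b| + `|c|) * `|z|.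
  rewrite (le_trans (ler_normD _ _))// normrM mulrDl lerD2l.
  by rewrite ler_peMr.
have h2 : std_pdf z <= 2 * c0 * `|z| ^-2.
  rewrite std_pdfE expRN [leRHS](_ : _ = c0 * (2 / `|z| ^+ 2)); last by ring.
  apply: ler_wpM2l => //; rewrite ler_pdivlMr ?exprn_gt0//.
  rewrite mulrC ler_pdivrMr ?expR_gt0//.
  have := expR_ge1Dx (z ^+ 2 / 2); rewrite real_normK ?num_real//; lra.
apply: le_trans (ler_pM (normr_ge0 _) (std_pdf_ge0 z) h1 h2) _.
rewrite le_eqVlt; apply/orP; left; apply/eqP; field.
by rewrite gt_eqF.
Qed.

Lemma affine_std_pdf_cvg0 b c : (b * z + c) * std_pdf z @[z --> +oo] --> (0 : R).
Proof.
apply/cvgr0Pnorm_le => e e0.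
pose K := 2 * c0 * (`|b| + `|c|).
have K0 : 0 <= K by rewrite !mulr_ge0// ?normal_peak_ge0// addr_ge0.
near=> z.
have z1 : 1 <= `|z| by rewrite (le_trans _ (ler_norm z)).
apply: le_trans (affine_std_pdf_bound b c z1) _.
rewrite ler_pdivrMr ?(lt_le_trans _ z1)// -ler_pdivrMl//.
by rewrite (le_trans _ (ler_norm z)).
Unshelve. all: by end_near. Qed.

Lemma continuous_affine_std_pdf b c :
  continuous (fun z => ((b * z + c) * z - b) * std_pdf z).
Proof.
move=> x; apply: cvgM; last exact: continuous_std_pdf.
apply: cvgB; last exact: cvg_cst.
apply: cvgM; last exact: cvg_id.
by apply: cvgD; [apply: cvgM; [exact: cvg_cst|exact: cvg_id]|exact: cvg_cst].
Qed.

(** The fundamental theorem on an unbounded interval is applied to a nonnegative integrand; the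
    conditions on [b] and [c] make it nonnegative beyond some [K], and the compact piece [a, K] is
    treated separately. *)
Lemma integral_affine_std_pdf a b c : 0 <= b -> (0 < b) || (0 <= c) ->
  (\int[mu]_(z in `[a, +oo[) (((b * z + c) * z - b) * std_pdf z)%:E =
   ((b * a + c) * std_pdf a)%:E)%E.
Proof.
move=> b0 bc.
pose F x := - ((b * x + c) * std_pdf x).
pose f x := ((b * x + c) * x - b) * std_pdf x.
have Fd x : derivable F x 1 by have [] := is_derive_affine_std_pdf b c x.
have dFE x : derive1 F x = f x.
  by rewrite derive1E; have [_ ->] := is_derive_affine_std_pdf b c x.
have cF : continuous F by move=> x; apply/differentiable_continuous/derivable1_diffP.
have cf : continuous f by exact: continuous_affine_std_pdf.
(* For b > 0, z >= 1 + |c|/b gives b z + c >= b, and then z >= 1 gives (b z + c) z >= b. *)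
have [K aK fK] : exists2 K, a < K & forall z, K <= z -> 0 <= f z.
  have [b00|b00] := ltP 0 b.
    exists (Num.max (a + 1) (Num.max 1 (1 + `|c| / b))).
      by rewrite lt_max ltrDl ltr01.
    move=> z; rewrite !ge_max => /and3P[_ z1 zc].
    rewrite /f mulr_ge0 ?std_pdf_ge0//.
    have h : b <= b * z + c.
      have : b * (1 + `|c| / b) <= b * z by rewrite ler_wpM2l.
      rewrite mulrDr mulr1 mulrC divfK ?gt_eqF//.
      have := ler_norm (- c); rewrite normrN; lra.
    nra.
  have bE : b = 0 by apply/eqP; rewrite eq_le b0 b00.
  have {}bc : 0 <= c by move: bc; rewrite bE ltxx.
  exists (Num.max (a + 1) 1); first by rewrite lt_max ltrDl ltr01.
  move=> z; rewrite ge_max => /andP[_ z1].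
  rewrite /f mulr_ge0 ?std_pdf_ge0// bE; nra.
have -> : `[a, +oo[%classic = `[a, K] `|` `]K, +oo[ :> set R.
  by rewrite -itv_bndbnd_setU ?bnd_simp ?ltW.
rewrite integral_setU//=; last 2 first.
  by apply/measurable_EFinP; apply: measurable_funTS; exact: continuous_measurable_fun.
  apply/disj_setPS => z /=; rewrite !in_itv/= andbT => -[/andP[_ h1] h2].
  by move: (le_lt_trans h1 h2); rewrite ltxx.
rewrite integral_itv_obnd_cbnd; last first.
  by apply/measurable_EFinP; apply: measurable_funTS; exact: continuous_measurable_fun.
rewrite (@continuous_FTC2 _ f F)//; last 2 first.
- exact: continuous_subspaceT.
- by split => //; [exact/cvg_at_right_filter/cF|exact/cvg_at_left_filter/cF].
rewrite (@ge0_continuous_FTC2y _ f F _ 0)//.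
- by rewrite /F -!EFinB -EFinD; congr EFin; ring.
- exact: continuous_subspaceT.
- rewrite -oppr0; apply: cvgN; exact: affine_std_pdf_cvg0.
- exact/cvg_at_right_filter/cF.
Qed.

End std_normal_pdf.

(** * Transfer of integrals for functions of arbitrary sign *)

Section transfer_signed.
Context d1 d2 (T1 : measurableType d1) (T2 : measurableType d2) (R : realType).
Context (mu1 : {measure set T1 -> \bar R}) (mu2 : {measure set T2 -> \bar R}).
Context (Y1 : T1 -> R) (Y2 : T2 -> R) (p1 : T1 -> R) (p2 : T2 -> R).
Hypothesis mY1 : measurable_fun setT Y1.
Hypothesis mY2 : measurable_fun setT Y2.
Hypothesis mp1 : measurable_fun setT p1.
Hypothesis mp2 : measurable_fun setT p2.
Hypothesis p1_ge0 : forall x, 0 <= p1 x.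
Hypothesis p2_ge0 : forall x, 0 <= p2 x.

(** As the weights are nonnegative, the positive and negative parts of f(Y) p are those of f,
    composed with Y, times p; the nonnegative case applies to each. *)
Lemma integral_transfer_signed (f : R -> R) :
  (forall A : set R, measurable A ->
    weighted_law mu1 Y1 p1 A = weighted_law mu2 Y2 p2 A) ->
  measurable_fun setT f ->
  (\int[mu1]_x (f (Y1 x) * p1 x)%:E = \int[mu2]_x (f (Y2 x) * p2 x)%:E)%E.
Proof.
move=> p12 mf; rewrite integralE [RHS]integralE.
have posE (a p : R) : 0 <= p -> Num.max (a * p) 0 = Num.max a 0 * p.
  by move=> p0; rewrite maxr_pMl// mul0r.
congr (_ - _)%E.
- transitivity (\int[mu1]_x (Num.max (f (Y1 x)) 0 * p1 x)%:E)%E.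
    by apply: eq_integral => x _; rewrite funeposE -EFin_max posE.
  transitivity (\int[mu2]_x (Num.max (f (Y2 x)) 0 * p2 x)%:E)%E; last first.
    by apply: eq_integral => x _; rewrite funeposE -EFin_max posE.
  apply: (integral_transfer mY1 mY2 mp1 mp2 p1_ge0 p2_ge0
    (f := fun y => Num.max (f y) 0)) => //.
    exact: measurable_maxr.
  by move=> x; rewrite le_max lexx orbT.
- transitivity (\int[mu1]_x (Num.max (- f (Y1 x)) 0 * p1 x)%:E)%E.
    by apply: eq_integral => x _; rewrite funenegE -EFinN -EFin_max -mulNr posE.
  transitivity (\int[mu2]_x (Num.max (- f (Y2 x)) 0 * p2 x)%:E)%E; last first.
    by apply: eq_integral => x _; rewrite funenegE -EFinN -EFin_max -mulNr posE.
  apply: (integral_transfer mY1 mY2 mp1 mp2 p1_ge0 p2_ge0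
    (f := fun y => Num.max (- f y) 0)) => //.
    by apply: measurable_maxr => //; exact: measurable_funN.
  by move=> x; rewrite le_max lexx orbT.
Qed.

End transfer_signed.

(** * Elementary inequalities and integrals of real-valued functions *)

Notation integrableR P f := (P.-integrable setT (EFin \o f)).

(** This crude Young inequality stands in for Hölder's. It is not homogeneous, which is why Gaussian
    factors are divided by their size [h] before it is applied. *)
Lemma normM_le_sqrD (R : realDomainType) (x y : R) :
  `|x * y| <= x ^+ 2 + y ^+ 2.
Proof.
by rewrite ler_norml; have := sqr_ge0 (x + y); have := sqr_ge0 (x - y); nra.
Qed.

Lemma exprn4_1D_le (R : realDomainType) (u : R) :
  (1 + u) ^+ 4 <= 8 * (1 + u ^+ 4).
Proof.
have h : (1 + u) ^+ 2 <= 2 * (1 + u ^+ 2) by have := sqr_ge0 (1 - u); nra.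
have h' : (1 + u ^+ 2) ^+ 2 <= 2 * (1 + u ^+ 4).
  by have := sqr_ge0 (1 - u ^+ 2); nra.
rewrite (exprM _ 2 2) (@le_trans _ _ ((2 * (1 + u ^+ 2)) ^+ 2))//.
  by rewrite lerXn2r// nnegrE ?sqr_ge0// mulr_ge0// addr_ge0// sqr_ge0.
by rewrite exprMn; lra.
Qed.

(** Eight is the highest moment that occurs: squared increments multiply Taylor remainders known in
    L^4 only, so the squares are needed in L^4 too. *)
Lemma normX_le_1DX8 (R : realDomainType) (z : R) k : (k <= 8)%N ->
  `|z ^+ k| <= 1 + z ^+ 8.
Proof.
move=> k8; rewrite normrX -[z ^+ 8]ger0_norm ?exprn_even_ge0// normrX.
have [z1|z1] := leP `|z| 1.
  by rewrite (@le_trans _ _ 1)// ?exprn_ile1// lerDl exprn_ge0.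
rewrite (@le_trans _ _ (`|z| ^+ 8))// ?lerDr//.
by rewrite ler_weXn2l// ltW.
Qed.

Section integrableR.
Context d (T : measurableType d) (R : realType) (P : probability T R).
Implicit Types f g : T -> R.

Lemma integrableR_measurable f : integrableR P f -> measurable_fun setT f.
Proof. by move=> /measurable_int/measurable_EFinP. Qed.

Lemma integrableR_le f g : measurable_fun setT f -> integrableR P g ->
  (forall x, `|f x| <= g x) -> integrableR P f.
Proof.
move=> mf ig fg; apply: le_integrable ig => //; first exact/measurable_EFinP.
by move=> x _ /=; rewrite lee_fin (le_trans (fg x))// ler_norm.
Qed.

Lemma integrableR_cst (c : R) : integrableR P (fun=> c).
Proof. exact: finite_measure_integrable_cst. Qed.

Lemma integrableRD f g : integrableR P f -> integrableR P g ->
  integrableR P (fun x => f x + g x).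
Proof. by move=> /integrableD h /h; exact. Qed.

Lemma integrableRB f g : integrableR P f -> integrableR P g ->
  integrableR P (fun x => f x - g x).
Proof. by move=> /integrableB h /h; exact. Qed.

Lemma integrableRZ c f : integrableR P f -> integrableR P (fun x => c * f x).
Proof. by move=> /(integrableZl measurableT c). Qed.

Lemma integrableRM f g : measurable_fun setT f -> measurable_fun setT g ->
  integrableR P (fun x => f x ^+ 2) -> integrableR P (fun x => g x ^+ 2) ->
  integrableR P (fun x => f x * g x).
Proof.
move=> mf mg if2 ig2; apply: (integrableR_le _ (integrableRD if2 ig2)).
  by mfun.
by move=> x; exact: normM_le_sqrD.
Qed.

Lemma integrableR_sqr f : measurable_fun setT f ->
  integrableR P (fun x => f x ^+ 2) -> integrableR P f.
Proof.
move=> mf if2.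
apply: (integrableR_le mf (integrableRD (integrableR_cst 1) if2)) => x.
by have := normM_le_sqrD 1 (f x); rewrite mul1r expr1n.
Qed.

Lemma integralE_R f : integrableR P f ->
  (\int[P]_x (f x)%:E)%E = (\int[P]_x f x)%:E.
Proof. by move=> h; rewrite /Rintegral fineK// integrable_fin_num. Qed.

Lemma RintegralE_cst (c : R) : \int[P]_x c = c.
Proof. by rewrite /Rintegral integral_cst//= probability_setT mule1. Qed.

Lemma normr_Rintegral_le f g : measurable_fun setT f -> integrableR P g ->
  (forall x, `|f x| <= g x) -> `|\int[P]_x f x| <= \int[P]_x g x.
Proof.
move=> mf ig fg; have fi := integrableR_le mf ig fg.
apply: le_trans (le_normr_Rintegral _ fi) _ => //.
apply: le_Rintegral => //; exact: integrable_norm.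
Qed.

Lemma Rdominated_convergence (f_ : nat -> T -> R) f g :
  (forall n, measurable_fun setT (f_ n)) -> measurable_fun setT f ->
  {ae P, forall x, f_ n x @[n --> \oo] --> f x} -> integrableR P g ->
  (forall n x, `|f_ n x| <= g x) ->
  \int[P]_x f_ n x @[n --> \oo] --> \int[P]_x f x.
Proof.
move=> mf_ mf f_f ig f_g.
have [|||||ifoo _ cvgf] := @dominated_convergence _ _ _ P setT measurableT
  (fun n x => (f_ n x)%:E) (EFin \o f) (fun x => (g x)%:E).
- by move=> n; exact/measurable_EFinP.
- exact/measurable_EFinP.
- by apply: filterS f_f => x fx _; apply: cvg_EFin => //; exact: nearW.
- exact: ig.
- by apply: aeW => x n _; rewrite lee_fin.
by apply: fine_cvg; rewrite -integralE_R//; exact: cvgf.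
Qed.

End integrableR.

(** * Moments of the standard normal law and Stein's identity *)

Section std_normal.
Context {R : realType}.
Local Notation mu := (@lebesgue_measure R).
Local Notation gam := (normal_prob (0 : R) 1).
Implicit Types (a b c z : R).

(** [normal_prob 0 1] is by definition the weighted law of the identity with weight [std_pdf] under
    Lebesgue measure, so the transfer lemma applies. *)
Lemma integral_std_normal (h : R -> R) : measurable_fun setT h ->
  (\int[gam]_z (h z)%:E = \int[mu]_z (h z * std_pdf z)%:E)%E.
Proof.
move=> mh; rewrite -(@integral_transfer_signed _ _ _ _ _ gam mu id id (cst 1) std_pdf)//.
- by apply: eq_integral => x _; rewrite mulr1.
- exact: measurable_normal_pdf.
- exact: std_pdf_ge0.
- move=> A mA; rewrite /weighted_law preimage_id.
  by rewrite [LHS](integral_cst gam mA 1%:E) mul1e.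
Qed.

(** Comparison with the normal density of standard deviation 2. The exponents -z^2/2 and -z^2/8
    differ by 3 z^2/8, and x <= exp x at x = 3 z^2/32, raised to the fourth power, absorbs z^8; this
    gives (32/3)^4. The factor 2 is the ratio of the two peaks. *)
Lemma integrable_std_normal_X8 : integrableR gam (fun z => z ^+ 8).
Proof.
have mX : measurable_fun setT (fun z : R => z ^+ 8) by exact: measurable_funX.
apply/integrableP; split; first exact/measurable_EFinP.
pose C : R := (32 / 3) ^+ 4 * 2.
have C0 : 0 <= C by rewrite mulr_ge0// exprn_ge0//; lra.
rewrite [ltLHS](_ : _ = \int[gam]_z (z ^+ 8)%:E)%E; last first.
  by apply: eq_integral => z _ /=; rewrite ger0_norm// exprn_even_ge0.
rewrite integral_std_normal//.
apply: (@le_lt_trans _ _ (\int[mu]_z (C * normal_pdf 0 2 z)%:E))%E; last first.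
  under eq_integral do rewrite EFinM.
  rewrite integralZl//; last exact: integrable_normal_pdf.
  by rewrite integral_normal_pdf mule1 ltry.
apply: ge0_le_integral => //.
- by move=> z _; rewrite lee_fin mulr_ge0 ?std_pdf_ge0// exprn_even_ge0.
- apply/measurable_EFinP; apply: measurable_funM => //.
  exact: measurable_normal_pdf.
- apply/measurable_EFinP; apply: measurable_funM => //.
  exact: measurable_normal_pdf.
move=> z _; rewrite lee_fin std_pdfE normal_pdfE ?pnatr_eq0// /normal_fun subr0.
have pk : normal_peak 1 = 2 * normal_peak (2 : R).
  rewrite /normal_peak expr1n mul1r -mulrnAr sqrtrM ?sqr_ge0// sqrtr_sqr.
  by rewrite ger0_norm// invfM mulrA divff ?mul1r// pnatr_eq0.
have h : z ^+ 8 <= (32 / 3) ^+ 4 * expR (3 * z ^+ 2 / 8).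
  rewrite [z ^+ 8](_ : _ = (32 / 3) ^+ 4 * (3 * z ^+ 2 / 32) ^+ 4); last by field.
  apply: ler_wpM2l; first by rewrite exprn_ge0//; lra.
  rewrite [3 * z ^+ 2 / 8](_ : _ = (3 * z ^+ 2 / 32) * 4%:R); last by field.
  rewrite expRM_natr lerXn2r ?nnegrE ?expR_ge0//.
    by rewrite divr_ge0// mulr_ge0// sqr_ge0.
  by have := expR_ge1Dx (3 * z ^+ 2 / 32); lra.
apply: (@le_trans _ _ (((32 / 3) ^+ 4 * expR (3 * z ^+ 2 / 8)) * (normal_peak 1 * expR (- (z ^+ 2 / 2))))).
  by rewrite ler_wpM2r// mulr_ge0 ?expR_ge0// normal_peak_ge0.
rewrite le_eqVlt; apply/orP; left; apply/eqP.
rewrite pk [- z ^+ 2 / _](_ : _ = (3 * z ^+ 2 / 8) - (z ^+ 2 / 2)).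
  by rewrite expRD /C; ring.
by rewrite -mulr_natr; field.
Qed.

Lemma integrable_std_normal_X k : (k <= 8)%N -> integrableR gam (fun z => z ^+ k).
Proof.
move=> k8; apply: (integrableR_le _ (integrableRD (integrableR_cst gam 1) integrable_std_normal_X8)).
  exact: measurable_funX.
by move=> z; exact: normX_le_1DX8.
Qed.

Lemma std_normal_tail a b c : 0 <= b -> (0 < b) || (0 <= c) ->
  \int[gam]_z (\1_`[a, +oo[ z * ((b * z + c) * z - b)) = (b * a + c) * std_pdf a.
Proof.
move=> b0 bc; rewrite /Rintegral integral_std_normal; last first.
  by mfun.
rewrite (_ : integral _ _ _ = \int[mu]_(z in `[a, +oo[) (((b * z + c) * z - b) * std_pdf z)%:E)%E.
  by rewrite integral_affine_std_pdf.
rewrite [RHS]integral_mkcond; apply: eq_integral => z _.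
by rewrite epatch_indic -EFinM; congr EFin; ring.
Qed.

Lemma integrable_std_normal_quadratic a b c :
  integrableR gam (fun z => a * z ^+ 2 + b * z + c).
Proof.
apply: integrableRD; last exact: integrableR_cst.
by apply: integrableRD; apply: integrableRZ;
  [exact: (@integrable_std_normal_X 2)|exact: (@integrable_std_normal_X 1)].
Qed.

(** The limit of [std_normal_tail] along a = -n: the left side converges by dominated convergence
    and the boundary term vanishes. *)
Lemma std_normal_affine b c : 0 <= b -> (0 < b) || (0 <= c) ->
  \int[gam]_z ((b * z + c) * z - b) = 0.
Proof.
move=> b0 bc.
pose h z := (b * z + c) * z - b.
have ih : integrableR gam h.
  apply: eq_integrable (integrable_std_normal_quadratic b c (- b)) => //.
  by move=> z _ /=; congr EFin; rewrite /h; ring.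
have mh := integrableR_measurable ih.
have fh : \int[gam]_z (\1_`[- n%:R, +oo[ z * h z) @[n --> \oo] --> \int[gam]_z h z.
  apply: (@Rdominated_convergence _ _ _ gam _ _ (fun z => `|h z|)).
  - by move=> n; mfun.
  - exact: mh.
  - apply: aeW => z; apply: cvg_near_cst; near=> n.
    rewrite indicE mem_set ?mul1r//= in_itv/= andbT lerNl.
    rewrite (le_trans (ler_norm _))// normrN.
    near: n; exact: nbhs_infty_ger.
  - exact: integrable_norm.
  - move=> n z; rewrite normrM ler_piMl// indicE.
    by case: (_ \in _); rewrite ?normr1 ?normr0.
apply: cvg_unique fh _ => //.
have -> : (fun n : nat => \int[gam]_z (\1_`[- n%:R, +oo[ z * h z)) =
    (fun n => (b * - n%:R + c) * std_pdf (- n%:R)).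
  by apply/funext => n; exact: std_normal_tail.
apply/cvgr0Pnorm_le => e e0.
pose K := 2 * normal_peak (1 : R) * (`|b| + `|c|).
near=> n.
have n1 : 1 <= `|- n%:R : R|.
  by rewrite normrN ger0_norm//; near: n; exact: nbhs_infty_ger.
apply: le_trans (affine_std_pdf_bound b c n1) _.
rewrite ler_pdivrMr ?(lt_le_trans _ n1)// -ler_pdivrMl//.
rewrite normrN (@ger0_norm _ n%:R)//.
by near: n; exact: nbhs_infty_ger.
Unshelve. all: by end_near. Qed.

Lemma std_normal_mean : \int[gam]_z z = 0.
Proof.
rewrite -[RHS](@std_normal_affine 0 1)// ?ler01 ?orbT//.
by apply: eq_Rintegral => z _; ring.
Qed.

Lemma std_normal_variance : \int[gam]_z z ^+ 2 = 1.
Proof.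
have := @std_normal_affine 1 0 ler01; rewrite ltr01 => /(_ isT).
under eq_Rintegral do rewrite mul1r addr0 -expr2.
rewrite RintegralB//; last 2 first.
- exact: (@integrable_std_normal_X 2).
- exact: integrableR_cst.
by rewrite RintegralE_cst => /eqP; rewrite subr_eq0 => /eqP.
Qed.

Lemma integrable_std_normal_relu a :
  integrableR gam (fun z => Num.max (z - a) 0 * z).
Proof.
apply: (integrableR_le _ (integrable_std_normal_quadratic (1 + `|a|) 0 `|a|)).
  apply: measurable_funM => //; apply: measurable_maxr => //.
  exact: measurable_funB.
move=> z; rewrite normrM.
have h : `|Num.max (z - a) 0| <= `|z| + `|a|.
  rewrite ger0_norm ?le_max ?lexx ?orbT// ge_max addr_ge0// andbT.
  by rewrite (le_trans (ler_norm _))// ler_normB.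
rewrite (le_trans (ler_wpM2r _ h))//.
have : `|a| * `|z| <= `|a| * (1 + `|z| ^+ 2).
  by rewrite ler_wpM2l//; have := sqr_ge0 (`|z| - 1); have := normr_ge0 z; nra.
by rewrite -(real_normK (num_real z)); lra.
Qed.

(** On [a, +oo[ the difference of the two integrands is (z - a) z - 1, which is the case b = 1, c =
    -a of [std_normal_tail]; its boundary term vanishes at a. *)
Lemma std_normal_stein a :
  \int[gam]_z (Num.max (z - a) 0 * z) = fine (gam `]a, +oo[%classic).
Proof.
rewrite (_ : gam `]a, +oo[%classic = gam `[a, +oo[%classic); last first.
  apply: integral_itv_obnd_cbnd.
  by apply/measurable_EFinP; apply: measurable_funTS; exact: measurable_normal_pdf.
have mI : measurable (`[a, +oo[%classic : set R) by exact: measurable_itv.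
have iI : integrableR gam (\1_`[a, +oo[ : R -> R).
  exact: integrable_indic.
have i1 := integrable_std_normal_relu a.
have := @std_normal_tail a 1 (- a) ler01; rewrite ltr01 => /(_ isT).
rewrite mul1r subrr mul0r.
rewrite (_ : Rintegral _ _ _ = \int[gam]_z (Num.max (z - a) 0 * z - \1_`[a, +oo[ z)).
  rewrite (RintegralB measurableT i1 iI) => /eqP; rewrite subr_eq0 => /eqP ->.
  by rewrite /Rintegral integral_indic// setIT.
apply: eq_Rintegral => z _.
rewrite indicE mul1r; have [az|az] := leP a z.
  by rewrite mem_set/= ?in_itv/= ?az// max_l ?subr_ge0//; ring.
by rewrite memNset/= ?in_itv/= ?andbT ?leNgt ?az// max_r ?subr_le0 ?ltW//; ring.
Qed.

End std_normal.

(** * Gaussian random variables *)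

(** Written as the image of the standard normal law under an affine map, so that s = 0 gives the
    Dirac mass without a case distinction. *)
Definition normal_law d (Omega : measurableType d) (R : realType)
    (P : probability Omega R) (X : Omega -> R) (m s : R) : Prop :=
  forall A : set R, measurable A ->
    P (X @^-1` A) = normal_prob 0 1 ((fun z => m + s * z) @^-1` A).

Section normal_law.
Context d (Omega : measurableType d) (R : realType) (P : probability Omega R).
Local Notation gam := (normal_prob (0 : R) 1).
Local Notation mu := (@lebesgue_measure R).
Implicit Types (X : Omega -> R) (m s a b : R).

Lemma normal_law_integral X m s (h : R -> R) : measurable_fun setT X ->
  normal_law P X m s -> measurable_fun setT h ->
  (\int[P]_w (h (X w))%:E = \int[gam]_z (h (m + s * z))%:E)%E.
Proof.
move=> mX lX mh.
have ms : measurable_fun setT (fun z : R => m + s * z) by mfun.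
transitivity (\int[P]_w (h (X w) * cst 1 w)%:E)%E.
  by apply: eq_integral => w _; rewrite mulr1.
transitivity (\int[gam]_z (h (m + s * z) * cst 1 z)%:E)%E; last first.
  by apply: eq_integral => z _; rewrite mulr1.
apply: (@integral_transfer_signed _ _ _ _ _ P gam X (fun z => m + s * z) (cst 1) (cst 1)) => // A mA.
rewrite /weighted_law.
rewrite [LHS](integral_cst P (measurable_preimage mX mA) 1%:E) mul1e.
rewrite [RHS](integral_cst gam (measurable_preimage ms mA) 1%:E) mul1e.
exact: lX.
Qed.

Lemma normal_law_Rintegral X m s (h : R -> R) : measurable_fun setT X ->
  normal_law P X m s -> measurable_fun setT h ->
  \int[P]_w (h (X w)) = \int[gam]_z (h (m + s * z)).
Proof. by move=> mX lX mh; rewrite /Rintegral (normal_law_integral mX lX). Qed.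

Lemma normal_law_integrable X m s (h : R -> R) : measurable_fun setT X ->
  normal_law P X m s -> measurable_fun setT h ->
  integrableR gam (fun z => h (m + s * z)) -> integrableR P (fun w => h (X w)).
Proof.
move=> mX lX mh /integrableP[_ ih]; apply/integrableP; split.
  by apply/measurable_EFinP; exact: measurableT_comp.
have := @normal_law_integral X m s (fun x => `|h x|) mX lX.
rewrite /= => ->; last by mfun.
exact: ih.
Qed.

Lemma normal_law_affine X m s a b : measurable_fun setT X ->
  normal_law P X m s ->
  normal_law P (fun w => a + b * X w) (a + b * m) (b * s).
Proof.
move=> mX lX A mA.
have mab : measurable_fun setT (fun x : R => a + b * x) by mfun.
have := lX _ (measurable_preimage mab mA).
rewrite (_ : X @^-1` _ = (fun w => a + b * X w) @^-1` A)// => ->.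
congr (gam _); apply/seteqP; split => z /=;
  by rewrite mulrDr addrA mulrA.
Qed.

Lemma normal_law_ext X Y m s : X =1 Y -> normal_law P X m s -> normal_law P Y m s.
Proof. by move=> /funext ->. Qed.

(** For s != 0 the two laws agree on half-lines by the substitution y = m + |s| z, hence on all
    Borel sets by [weighted_law_unique] with weight 1. The sign of s is immaterial because the
    density depends on s^2 only. *)
Lemma gaussian_rv_normal_law X : gaussian_rv P X ->
  exists m s, 0 <= s /\ normal_law P X m s.
Proof.
move=> [m [s Xms]]; exists m, `|s|; split => // A mA; rewrite Xms//.
have [s0|s0] := eqVneq s 0.
  rewrite s0 normr0 diracE; have [mA'|mA'] := boolP (m \in A).
    rewrite (_ : _ @^-1` A = setT); first exact/esym/(@probability_setT _ _ _ gam).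
    by apply/seteqP; split => // z _ /=; rewrite mul0r addr0; exact: set_mem.
  rewrite (_ : _ @^-1` A = set0) ?measure0//.
  apply/seteqP; split => // z /=; rewrite mul0r addr0.
  by move: mA'; rewrite notin_setE.
have t0 : 0 < `|s| by rewrite normr_gt0.
have mt : measurable_fun setT (fun z : R => m + `|s| * z) by mfun.
have := @weighted_law_unique _ _ _ _ _ (normal_prob m s) gam id (fun z => m + `|s| * z)
  (cst 1) (cst 1) (@measurable_id _ _ _) mt (measurable_cst _) (measurable_cst _) (fun=> ler01) (fun=> ler01).
have wE d' (T : measurableType d') (Q : probability T R) (Y : T -> R) B :
    measurable_fun setT Y -> measurable B ->
    weighted_law Q Y (cst 1) B = Q (Y @^-1` B).
  by move=> mY mB; rewrite /weighted_law (integral_cst Q (measurable_preimage mY mB) 1%:E) mul1e.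
move=> /(_ _ _ A mA); rewrite !wE//; apply.
  by rewrite (integral_cst (normal_prob m s) _ 1%:E)// mul1e (le_lt_trans (@probability_le1 _ _ _ (normal_prob m s) _ measurableT))// ltry.
move=> x; rewrite !wE// preimage_id.
pose F (z : R) := m + `|s| * z.
pose a := (x - m) / `|s|.
have Fa : F a = x by rewrite /F /a mulrC divfK ?gt_eqF// subrKC.
rewrite (_ : (fun z => m + `|s| * z) @^-1` _ = `]a, +oo[%classic); last first.
  by apply/seteqP; split => z /=; rewrite !in_itv/= !andbT /a ltr_pdivrMr// ltrBlDl (mulrC z).
have Fd (z : R) : is_derive z (1 : R) F `|s|.
  have H := is_deriveD (is_derive_cst m z (1:R)) (is_deriveM (is_derive_cst `|s| z (1:R)) (is_derive_id z (1:R))).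
  by apply: (is_derive_eq H); rewrite scaler0 addr0 add0r /cst /GRing.scale/= mulr1.
have dF : derive1 F = cst `|s|.
  by apply/funext => z; rewrite derive1E; have [_ ->] := Fd z.
have cF : continuous F.
  by move=> z; apply/differentiable_continuous/derivable1_diffP; have [] := Fd z.
change (\int[mu]_(y in `]x, +oo[) (normal_pdf m s y)%:E =
  \int[mu]_(z in `]a, +oo[) (std_pdf z)%:E)%E.
rewrite !integral_itv_obnd_cbnd; last 2 first.
- by apply/measurable_EFinP; apply: measurable_funTS; exact: measurable_normal_pdf.
- by apply/measurable_EFinP; apply: measurable_funTS; exact: measurable_normal_pdf.
rewrite -Fa increasing_ge0_integration_by_substitutiony//; first last.
- by move=> y _; exact: normal_pdf_ge0.
- by apply: continuous_subspaceT; exact: continuous_normal_pdf.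
- rewrite /F; apply/cvgryPge => A'; near=> z.
  rewrite -lerBlDl -ler_pdivrMl//; near: z; exact: nbhs_pinfty_ge.
- split; last exact/cvg_at_right_filter/cF.
  by move=> z _; have [] := Fd z.
- by rewrite dF; exact: is_cvg_cst.
- by rewrite dF; exact: is_cvg_cst.
- by rewrite dF => z _; exact: cvg_cst.
- by move=> y z _ _ yz; rewrite /F ltrD2l ltr_pM2l.
apply: eq_integral => z _; congr EFin.
rewrite /= dF /cst /= -/(std_pdf z) std_pdfE normal_pdfE// /normal_fun /F.
rewrite fctE /= /normal_peak expr1n mul1r -mulrnAr sqrtrM ?sqr_ge0// sqrtr_sqr.
rewrite [- (_ - m) ^+ 2 / _](_ : _ = - (z ^+ 2 / 2)); last first.
  rewrite -(mulr_natr (s ^+ 2)) -(real_normK (num_real s)).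
  by field; rewrite gt_eqF.
by rewrite invfM mulrAC (mulrAC _ _ `|s|) mulVf ?mul1r// gt_eqF.
Unshelve. all: by end_near. Qed.

Section moments.
Variables (X : Omega -> R) (m s : R).
Hypothesis (mX : measurable_fun setT X) (lX : normal_law P X m s).

Lemma normal_law_point x : s != 0 -> P (X @^-1` [set x]) = 0%E.
Proof.
move=> s0; rewrite lX//.
rewrite (_ : _ @^-1` [set x] = [set (x - m) / s]).
  by rewrite /normal_prob integral_set1.
apply/seteqP; split => z /=.
  by move=> <-; rewrite addrC addKr mulrC mulKf.
by move=> ->; rewrite mulrC divfK// subrKC.
Qed.

(** Cauchy-Schwarz for the vectors (m, s) and (1, z), raised to the fourth power; the defect in
    Cauchy-Schwarz is (m z - s)^2. *)
Let affine8_le z : (m + s * z) ^+ 8 <= (m ^+ 2 + s ^+ 2) ^+ 4 * (1 + z ^+ 2) ^+ 4.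
Proof.
rewrite -exprMn (exprM _ 2 4) lerXn2r ?nnegrE ?sqr_ge0//.
  by rewrite mulr_ge0// addr_ge0// sqr_ge0.
by have := sqr_ge0 (m * z - s); nra.
Qed.

Let integrable_1Dsqr4 : integrableR gam (fun z => (1 + z ^+ 2) ^+ 4).
Proof.
apply: (integrableR_le _ (integrableRZ 8
  (integrableRD (integrableR_cst gam 1) (@integrable_std_normal_X8 R)))).
  by mfun.
move=> z; rewrite ger0_norm ?exprn_ge0 ?addr_ge0 ?sqr_ge0//.
by rewrite (exprM z 2 4); exact: exprn4_1D_le.
Qed.

Lemma normal_law_integrableX k : (k <= 8)%N -> integrableR P (fun w => X w ^+ k).
Proof.
move=> k8.
have i8 : integrableR gam (fun z => (m + s * z) ^+ 8).
  apply: (integrableR_le _ (integrableRZ ((m ^+ 2 + s ^+ 2) ^+ 4) integrable_1Dsqr4)).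
    by mfun.
  by move=> z; rewrite ger0_norm ?exprn_even_ge0// affine8_le.
apply: (normal_law_integrable mX lX (h := fun x => x ^+ k)); first by mfun.
apply: (integrableR_le _ (integrableRD (integrableR_cst gam 1) i8)).
  by mfun.
by move=> z; exact: normX_le_1DX8.
Qed.

Lemma normal_law_mean : \int[P]_w X w = m.
Proof.
rewrite (normal_law_Rintegral mX lX (h := id))//.
rewrite RintegralD//; last 2 first.
  exact: integrableR_cst.
  by apply: integrableRZ; exact: (@integrable_std_normal_X _ 1).
rewrite RintegralE_cst RintegralZl//; last exact: (@integrable_std_normal_X _ 1).
by rewrite std_normal_mean mulr0 addr0.
Qed.

Lemma normal_law_sqr : \int[P]_w X w ^+ 2 = m ^+ 2 + s ^+ 2.
Proof.
rewrite (normal_law_Rintegral mX lX (h := fun x => x ^+ 2))//.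
transitivity (\int[gam]_z (m ^+ 2 + ((2 * m * s) * z + s ^+ 2 * z ^+ 2))).
  by apply: eq_Rintegral => z _; ring.
have i1 : integrableR gam (fun z => (2 * m * s) * z).
  by apply: integrableRZ; exact: (@integrable_std_normal_X _ 1).
have i2 : integrableR gam (fun z => s ^+ 2 * z ^+ 2).
  by apply: integrableRZ; exact: (@integrable_std_normal_X _ 2).
rewrite RintegralD//; last 2 first.
  exact: integrableR_cst.
  exact: integrableRD.
rewrite RintegralE_cst RintegralD// !RintegralZl//; last 2 first.
  exact: (@integrable_std_normal_X _ 2).
  exact: (@integrable_std_normal_X _ 1).
by rewrite std_normal_mean std_normal_variance mulr0 add0r mulr1.
Qed.

(** For normal variables the second moment controls the eighth, uniformly in m and s. This turns the
    scaling bound on E[X_r^2] into an L^8 bound. *)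
Lemma normal_law_X8 : \int[P]_w X w ^+ 8 <=
  (\int[P]_w X w ^+ 2) ^+ 4 * \int[gam]_z (1 + z ^+ 2) ^+ 4.
Proof.
rewrite normal_law_sqr (normal_law_Rintegral mX lX (h := fun x => x ^+ 8)); last by mfun.
rewrite -(RintegralZl _ measurableT integrable_1Dsqr4).
apply: le_Rintegral => //.
- apply: (integrableR_le _ (integrableRZ ((m ^+ 2 + s ^+ 2) ^+ 4) integrable_1Dsqr4)).
    by mfun.
  by move=> z; rewrite ger0_norm ?exprn_even_ge0// affine8_le.
- exact: (integrableRZ _ integrable_1Dsqr4).
Qed.

End moments.
End normal_law.

(** * Uncorrelated Gaussian variables *)

Section relu2.
Context {R : realType}.
Implicit Types x u v y w : R.

Definition relu2 x y : R := Num.max (y - x) 0 ^+ 2.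

(** The derivative 2 max(u - x, 0) is 2-Lipschitz, whence the constant 1 in front of (v - u)^2. The
    proof distinguishes the signs of u - x and v - x. *)
Lemma relu2_taylor x u v :
  `|relu2 x v - relu2 x u - 2 * Num.max (u - x) 0 * (v - u)| <= (v - u) ^+ 2.
Proof.
have [a ->] : exists a, u = x + a by exists (u - x); ring.
have [b ->] : exists b, v = x + b by exists (v - x); ring.
rewrite /relu2 ler_norml.
rewrite (_ : x + a - x = a); last by ring.
rewrite (_ : x + b - x = b); last by ring.
rewrite (_ : x + b - (x + a) = b - a); last by ring.
have := sqr_ge0 a; have := sqr_ge0 b; have := sqr_ge0 (b - a).
have [ha|ha] := leP 0 a; have [hb|hb] := leP 0 b.
- by move=> h1 h2 h3; apply/andP; split; nra.
- move=> h1 h2 h3.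
  by have := mulr_ge0_le0 ha (ltW hb); move=> h4; apply/andP; split; nra.
- move=> h1 h2 h3.
  by have := mulr_ge0_le0 hb (ltW ha); move=> h4; apply/andP; split; nra.
- by move=> h1 h2 h3; apply/andP; split; nra.
Qed.

Lemma relu2_ge0 x y : 0 <= relu2 x y. Proof. exact: sqr_ge0. Qed.

Lemma relu2_le x y : relu2 x y <= (y - x) ^+ 2.
Proof.
by rewrite /relu2 /Num.max; case: ifPn => _ //; rewrite expr0n sqr_ge0.
Qed.

(** In the symmetric second difference the first-order terms in [w] cancel, so the mixed moment of W
    with max(Y - x, 0) never has to be computed. *)
Definition relu2_diff x y w : R := relu2 x (y + w) + relu2 x (y - w) - 2 * relu2 x y.

Lemma relu2_diff_le x y w : `|relu2_diff x y w| <= 2 * w ^+ 2.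
Proof.
have := relu2_taylor x y (y + w); have := relu2_taylor x y (y - w).
rewrite /relu2_diff !ler_norml; move: (Num.max _ _) => m.
rewrite (_ : y - w - y = - w); last by ring.
rewrite (_ : y + w - y = w); last by ring.
move=> /andP[h1 h2] /andP[h3 h4]; apply/andP; split; nra.
Qed.

(** No kink lies within distance |w| of y, so [relu2 x] is there either exactly quadratic or
    zero. *)
Lemma relu2_diff_near x y w : `|w| < `|y - x| ->
  relu2_diff x y w = 2 * (\1_`]x, +oo[ y * w ^+ 2).
Proof.
rewrite ltr_norml /relu2_diff /relu2 indicE.
have [xy|xy] := ltP x y.
  rewrite gtr0_norm ?subr_gt0// => /andP[h1 h2].
  rewrite mem_set/= ?in_itv/= ?xy// !max_l; last 3 first.
  - lra.
  - lra.
  - lra.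
  by ring.
rewrite ler0_norm ?subr_le0// => /andP[h1 h2].
rewrite memNset/= ?in_itv/= ?andbT ?ltNge ?xy// !max_r; last 3 first.
- lra.
- lra.
- lra.
by ring.
Qed.

Lemma measurable_relu2 x : measurable_fun setT (relu2 x).
Proof. by rewrite /relu2; mfun. Qed.

End relu2.

Section uncorrelated_gaussian.
Context d (Omega : measurableType d) (R : realType) (P : probability Omega R).
Local Notation gam := (normal_prob (0 : R) 1).
Variables (Y W : Omega -> R) (m s : R).
Hypotheses (mY : measurable_fun setT Y) (mW : measurable_fun setT W).
Hypothesis gauss : forall b : R, exists m' s',
  0 <= s' /\ normal_law P (fun w => Y w + b * W w) m' s'.
Hypotheses (s_gt0 : 0 < s) (lY : normal_law P Y m s).
Hypothesis iW2 : integrableR P (fun w => W w ^+ 2).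
Hypotheses (EW : \int[P]_w W w = 0) (EYW : \int[P]_w (Y w * W w) = 0).
Local Notation sigma2 := (\int[P]_w W w ^+ 2).

Let iY2 : integrableR P (fun w => Y w ^+ 2).
Proof. exact: normal_law_integrableX lY _ _. Qed.

Let iY : integrableR P Y.
Proof. exact: (normal_law_integrableX mY lY (k := 1)). Qed.

Let iW : integrableR P W.
Proof. exact: integrableR_sqr. Qed.

Let iYW : integrableR P (fun w => Y w * W w).
Proof. exact: integrableRM. Qed.

(** Here the centring of W and its lack of correlation with Y enter: the first fixes the mean of Y +
    b W, the second makes the variances add up. *)
Let law_b b : exists s', [/\ 0 <= s', s' ^+ 2 = s ^+ 2 + b ^+ 2 * sigma2 &
  normal_law P (fun w => Y w + b * W w) m s'].
Proof.
have [m' [s' [s'0 l']]] := gauss b.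
have mb : measurable_fun setT (fun w => Y w + b * W w) by mfun.
have m'E : m' = m.
  rewrite -(normal_law_mean mb l') RintegralD//; last exact: integrableRZ.
  by rewrite RintegralZl// EW mulr0 addr0 (normal_law_mean mY lY).
rewrite {}m'E in l'; exists s'; split => //.
have := normal_law_sqr mb l'.
have -> : \int[P]_w (Y w + b * W w) ^+ 2 =
    \int[P]_w (Y w ^+ 2 + ((2 * b) * (Y w * W w) + b ^+ 2 * W w ^+ 2)).
  by apply: eq_Rintegral => w _; ring.
rewrite (RintegralD measurableT iY2); last first.
  by apply: integrableRD; apply: integrableRZ.
rewrite (RintegralD measurableT (integrableRZ _ iYW) (integrableRZ _ iW2)).
rewrite !RintegralZl// EYW mulr0 add0r (normal_law_sqr mY lY).
by lra.
Qed.

Section halfline.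
Variable x : R.
Let psi t := \int[gam]_z relu2 x (m + t * z).
Let p : R := fine (P (Y @^-1` `]x, +oo[)).

Let p01 : 0 <= p <= 1.
Proof.
rewrite /p fine_ge0//= -lee_fin fineK ?probability_le1//.
  exact: measurable_preimage.
exact/fin_num_measure/measurable_preimage.
Qed.

Let integrable_relu2 t : integrableR gam (fun z => relu2 x (m + t * z)).
Proof.
apply: (integrableR_le _ (integrable_std_normal_quadratic (t ^+ 2) (2 * t * (m - x)) ((m - x) ^+ 2))).
  by apply: measurableT_comp; [exact: measurable_relu2|mfun].
move=> z; rewrite ger0_norm ?relu2_ge0// (le_trans (relu2_le _ _))//.
by rewrite le_eqVlt; apply/orP; left; apply/eqP; ring.
Qed.

Let measurable_halfline : measurable (`]x, +oo[%classic : set R).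
Proof. exact: measurable_itv. Qed.

Let stein : \int[gam]_z (Num.max (m + s * z - x) 0 * z) = s * p.
Proof.
pose a := (x - m) / s.
transitivity (\int[gam]_z (s * (Num.max (z - a) 0 * z))).
  apply: eq_Rintegral => z _; rewrite mulrA maxr_pMr ?ltW// mulr0.
  by congr (Num.max _ _ * _); rewrite /a; field; rewrite gt_eqF.
rewrite RintegralZl//; last exact: integrable_std_normal_relu.
rewrite std_normal_stein /p lY//; congr (s * fine (gam _)).
apply/seteqP; split => z /=; rewrite !in_itv/= !andbT /a.
  by rewrite ltr_pdivrMr// (mulrC z); lra.
by rewrite ltr_pdivrMr// (mulrC z); lra.
Qed.

(** This is [relu2_taylor] between m + s z and m + t z, integrated in z. Stein's identity identifies
    the first-order coefficient, that is psi'(s) = 2 s p, and E[z^2] = 1 gives the remainder. *)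
Let psi_bound t : `|psi t - psi s - 2 * (t - s) * (s * p)| <= (t - s) ^+ 2.
Proof.
have ir : integrableR gam (fun z => Num.max (m + s * z - x) 0 * z).
  apply: (integrableR_le _ (integrableRD (integrable_relu2 s) (@integrable_std_normal_X _ 2 isT))).
    by mfun.
  move=> z; rewrite /relu2; move: (Num.max _ _) => r.
  by have := sqr_ge0 (r + z); have := sqr_ge0 (r - z); rewrite ler_norml; nra.
rewrite -stein -RintegralB// -RintegralZl// -RintegralB//; last 2 first.
- exact: integrableRB.
- exact: integrableRZ.
apply: (@le_trans _ _ (\int[gam]_z ((t - s) ^+ 2 * z ^+ 2))); last first.
  rewrite RintegralZl//; last exact: (@integrable_std_normal_X _ 2).
  by rewrite std_normal_variance mulr1.
apply: normr_Rintegral_le.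
- apply: measurable_funB; last by mfun.
  by apply: measurable_funB; apply: (integrableR_measurable (integrable_relu2 _)).
- by apply: integrableRZ; exact: (@integrable_std_normal_X _ 2).
- move=> z; have := relu2_taylor x (m + s * z) (m + t * z).
  rewrite (_ : m + t * z - (m + s * z) = (t - s) * z); last by ring.
  rewrite exprMn; apply: le_trans; rewrite le_eqVlt; apply/orP; left.
  by apply/eqP; congr `|_|; ring.
Qed.

(** Let t be the standard deviation of Y + b W and c = b^2 sigma2. From t^2 - s^2 = c follow 2 (t -
    s) s = c - (t - s)^2 and t - s <= c / s. The first order in t - s thus becomes the second order
    in b, with two errors of at most (c / s)^2. *)
Let relu2_bound b :
  `|\int[P]_w relu2 x (Y w + b * W w) - \int[P]_w relu2 x (Y w) - b ^+ 2 * sigma2 * p|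
  <= 2 * (b ^+ 2 * sigma2 / s) ^+ 2.
Proof.
have [t [t0 tE lt]] := law_b b.
rewrite (normal_law_Rintegral _ lt (measurable_relu2 x)); last by mfun.
rewrite (normal_law_Rintegral mY lY (measurable_relu2 x)).
have := psi_bound t; rewrite -/(psi t) -/(psi s).
have sig0 : 0 <= sigma2 by apply: Rintegral_ge0 => w _; exact: sqr_ge0.
set c := b ^+ 2 * sigma2 in tE *.
have c0 : 0 <= c by rewrite mulr_ge0// sqr_ge0.
have st : s <= t by rewrite -(@ler_pXn2r _ 2) ?nnegrE ?(ltW s_gt0)// tE lerDl.
have tsc : (t - s) <= c / s.
  rewrite ler_pdivlMr// (_ : c = (t - s) * (t + s)).
    by rewrite ler_wpM2l ?subr_ge0// lerDr.
  by rewrite -(addKr (s ^+ 2) c) -tE; ring.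
have tsc2 : (t - s) ^+ 2 <= (c / s) ^+ 2.
  by rewrite lerXn2r// nnegrE ?subr_ge0// divr_ge0// ltW.
have /andP[p0 p1] := p01.
have cE : 2 * (t - s) * (s * p) = c * p - (t - s) ^+ 2 * p.
  by rewrite -(addKr (s ^+ 2) c) -tE; ring.
have : (t - s) ^+ 2 * p <= (t - s) ^+ 2 by rewrite ler_piMr// sqr_ge0.
have : 0 <= (t - s) ^+ 2 * p by rewrite mulr_ge0// sqr_ge0.
rewrite cE !ler_norml; move: ((t - s) ^+ 2 * p) => q q0 q1 /andP[h1 h2].
by apply/andP; split; lra.
Qed.

Let integrable_halfline :
  integrableR P (fun w => \1_`]x, +oo[ (Y w) * W w ^+ 2).
Proof.
apply: (integrableR_le _ iW2); first by mfun.
move=> w; rewrite normrM ger0_norm// indicE; case: (_ \in _) => /=.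
  by rewrite mul1r ger0_norm ?sqr_ge0.
by rewrite mul0r sqr_ge0.
Qed.

Let uncorrelated_halfline :
  \int[P]_w (\1_`]x, +oo[ (Y w) * W w ^+ 2) = sigma2 * p.
Proof.
have irel b : integrableR P (fun w => relu2 x (Y w + b * W w)).
  have [t [_ _ lt]] := law_b b.
  apply: (normal_law_integrable _ lt (measurable_relu2 x)); first by mfun.
  exact: integrable_relu2.
have irel0 : integrableR P (fun w => relu2 x (Y w)).
  exact: (normal_law_integrable mY lY (measurable_relu2 x)).
pose b_ (n : nat) : R := n.+1%:R^-1.
have b0 n : 0 < b_ n by rewrite invr_gt0.
pose D_ (n : nat) w := (b_ n) ^- 2 * relu2_diff x (Y w) (b_ n * W w).
have iD n : integrableR P (D_ n).
  apply: integrableRZ; apply: integrableRB; last exact: integrableRZ.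
  apply: integrableRD; first exact: irel.
  by apply: eq_integrable (irel (- b_ n)) => // w _ /=; rewrite mulNr.
(* Off the event Y = x, which is null since s > 0, the quotients are eventually constant in n; they
   are dominated by 2 W^2. *)
have D_cvg : \int[P]_w D_ n w @[n --> \oo] -->
    \int[P]_w (2 * (\1_`]x, +oo[ (Y w) * W w ^+ 2)).
  apply: (@Rdominated_convergence _ _ _ P _ _ (fun w => 2 * W w ^+ 2)).
  - by move=> n; exact: integrableR_measurable (iD n).
  - by mfun.
  - exists (Y @^-1` [set x]); split.
    + exact: measurable_preimage.
    + by rewrite (normal_law_point lY)// gt_eqF.
    move=> w /=; apply: contra_notP => /eqP Yx; apply: cvg_near_cst; near=> n.
    rewrite /D_ relu2_diff_near; last first.
      rewrite normrM gtr0_norm// /b_ mulrC ltr_pdivrMr// mulrC -ltr_pdivrMr ?normr_gt0 ?subr_eq0//.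
      rewrite (@le_lt_trans _ _ n%:R)// ?ltr_nat//.
      by near: n; exact: nbhs_infty_ger.
    by rewrite exprMn; field; rewrite gt_eqF.
  - exact: integrableRZ.
  - move=> n w; rewrite /D_ normrM gtr0_norm ?invr_gt0 ?exprn_gt0//.
    rewrite ler_pdivrMl ?exprn_gt0// (le_trans (relu2_diff_le _ _ _))//.
    by rewrite exprMn le_eqVlt; apply/orP; left; apply/eqP; ring.
(* The same limit computed from the laws of Y + b W and Y - b W. *)
have D_cvg' : \int[P]_w D_ n w @[n --> \oo] --> 2 * (sigma2 * p).
  have ED n : \int[P]_w D_ n w = (b_ n) ^- 2 *
      ((\int[P]_w relu2 x (Y w + b_ n * W w) - \int[P]_w relu2 x (Y w)) +
       (\int[P]_w relu2 x (Y w + - b_ n * W w) - \int[P]_w relu2 x (Y w))).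
    rewrite -!RintegralB// -RintegralD//; last 2 first.
    - exact: integrableRB.
    - exact: integrableRB.
    rewrite -RintegralZl//; last by apply: integrableRD; exact: integrableRB.
    by apply: eq_Rintegral => w _; rewrite /D_ /relu2_diff mulNr; ring.
  apply/cvgrPdist_le => e e0; near=> n.
  (* Two errors 2 (b^2 sigma2 / s)^2, divided by b^2, leave K b^2, which is at most K b since b <=
     1. *)
  pose K := 4 * (sigma2 / s) ^+ 2.
  have h1 := relu2_bound (b_ n); have h2 := relu2_bound (- b_ n).
  rewrite sqrrN in h2.
  have bn1 : b_ n <= 1 by rewrite invf_le1// ler1n.
  have Ke : K * b_ n <= e.
    rewrite ler_pdivrMr// -ler_pdivrMl//.
    rewrite (@le_trans _ _ n%:R)// ?ler_nat//.
    by near: n; exact: nbhs_infty_ger.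
  apply: le_trans Ke; rewrite ED.
  apply: (@le_trans _ _ (K * b_ n ^+ 2)); last first.
    by apply: ler_wpM2l; [rewrite /K mulr_ge0 ?sqr_ge0|rewrite expr2 ler_piMr// ltW].
  move: h1 h2; set u := \int[P]_w _ - _; set v := \int[P]_w _ - _ => h1 h2.
  have bn2 : 0 < b_ n ^+ 2 by rewrite exprn_gt0.
  rewrite (_ : 2 * (sigma2 * p) - _ = b_ n ^- 2 *
    (- ((u - b_ n ^+ 2 * sigma2 * p) + (v - b_ n ^+ 2 * sigma2 * p)))); last first.
    by field; rewrite gt_eqF.
  rewrite normrM normrN gtr0_norm ?invr_gt0// ler_pdivrMl//.
  apply: le_trans (ler_normD _ _) _; apply: le_trans (lerD h1 h2) _.
  by rewrite le_eqVlt; apply/orP; left; apply/eqP; rewrite /K; ring.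
have DE : \int[P]_w (2 * (\1_`]x, +oo[ (Y w) * W w ^+ 2)) = 2 * (sigma2 * p).
  exact: cvg_unique D_cvg D_cvg'.
apply: (@mulfI _ (2 : R)); first by rewrite pnatr_eq0.
by rewrite -DE RintegralZl//; exact: integrable_halfline.
Unshelve. all: by end_near. Qed.

Lemma weighted_law_halfline :
  weighted_law P Y (fun w => W w ^+ 2) `]x, +oo[ =
  weighted_law P Y (cst sigma2) `]x, +oo[.
Proof.
have mI := measurable_preimage mY measurable_halfline.
transitivity (\int[P]_w (\1_`]x, +oo[ (Y w) * W w ^+ 2)%:E)%E.
  rewrite /weighted_law integral_mkcond; apply: eq_integral => w _.
  by rewrite epatch_indic -EFinM mulrC.
rewrite integralE_R; last exact: integrable_halfline.
rewrite uncorrelated_halfline [RHS](integral_cst P mI (sigma2)%:E) EFinM.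
by congr (_ * _)%E; rewrite /p fineK//; exact: fin_num_measure.
Qed.

End halfline.

(** The weights W^2 and [sigma2] induce the same weighted law of Y, as they agree on half-lines. The
    integrability of g(Y) W^2 is read off from the same identity in extended reals. *)
Lemma uncorrelated_sqr (g : R -> R) : measurable_fun setT g ->
  (forall y, 0 <= g y) -> integrableR P (g \o Y) ->
  integrableR P (fun w => g (Y w) * W w ^+ 2) /\
  \int[P]_w (g (Y w) * W w ^+ 2) = \int[P]_w g (Y w) * \int[P]_w W w ^+ 2.
Proof.
move=> mg g0 ig.
have sig0 : 0 <= sigma2 by apply: Rintegral_ge0 => w _; exact: sqr_ge0.
have mW2 : measurable_fun setT (fun w => W w ^+ 2) by mfun.
have W20 w : 0 <= W w ^+ 2 by exact: sqr_ge0.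
have foo : (\int[P]_w (W w ^+ 2)%:E < +oo)%E by rewrite integralE_R// ltry.
have gW : (\int[P]_w (g (Y w) * W w ^+ 2)%:E = (\int[P]_w g (Y w) * sigma2)%:E)%E.
  rewrite -RintegralZr// -integralE_R; last first.
    by apply: eq_integrable (integrableRZ sigma2 ig) => // w _ /=; rewrite mulrC.
  apply: (@integral_transfer _ _ _ _ _ P P Y Y (fun w => W w ^+ 2) (cst sigma2)) => //.
  apply: weighted_law_unique => //; exact: weighted_law_halfline.
split; last by rewrite /Rintegral gW.
apply/integrableP; split.
  by apply/measurable_EFinP; apply: measurable_funM => //; exact: measurableT_comp.
rewrite [ltLHS](_ : _ = \int[P]_w (g (Y w) * W w ^+ 2)%:E)%E; first by rewrite gW ltry.
by apply: eq_integral => w _ /=; rewrite ger0_norm// mulr_ge0.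
Qed.

End uncorrelated_gaussian.

(** * Regression on Y and the estimate for squares *)

(** The constant of [normal_law_X8]: it bounds the eighth moment of every normal variable whose
    second moment is at most 1. *)
Definition normal_moment8 (R : realType) : R :=
  \int[normal_prob (0 : R) 1]_z (1 + z ^+ 2) ^+ 4.

Lemma normal_moment8_ge0 (R : realType) : 0 <= normal_moment8 R.
Proof. by apply: Rintegral_ge0 => z _; rewrite exprn_ge0// addr_ge0// sqr_ge0. Qed.

Section quadratic_estimate.
Context d (Omega : measurableType d) (R : realType) (P : probability Omega R).

Definition jointly_normal (Y U : Omega -> R) : Prop :=
  forall a b : R, exists m s, 0 <= s /\ normal_law P (fun w => a * Y w + b * U w) m s.

Lemma jointly_normal_affine Y U (a b c : R) :
  measurable_fun setT Y -> measurable_fun setT U -> jointly_normal Y U ->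
  exists m s, 0 <= s /\ normal_law P (fun w => c + (a * Y w + b * U w)) m s.
Proof.
move=> mY mU /(_ a b) [m [s [s0 l]]]; exists (c + 1 * m), (1 * s); split.
  by rewrite mul1r.
have := @normal_law_affine _ _ _ _ _ _ _ c 1 _ l.
move=> /(_ ltac:(mfun)); apply: normal_law_ext => w; by rewrite mul1r.
Qed.

Lemma normal_scaled_moment8 X (m s h : R) : measurable_fun setT X ->
  normal_law P X m s -> 0 < h -> \int[P]_w X w ^+ 2 <= h ^+ 2 ->
  \int[P]_w (h^-1 * X w) ^+ 8 <= normal_moment8 R.
Proof.
move=> mX l h0 Xh.
have iX2 := normal_law_integrableX mX l (k := 2) isT.
have l' : normal_law P (fun w => h^-1 * X w) (0 + h^-1 * m) (h^-1 * s).
  apply: normal_law_ext (normal_law_affine 0 h^-1 mX l) => w.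
  by rewrite add0r.
have mX' : measurable_fun setT (fun w => h^-1 * X w) by mfun.
apply: le_trans (normal_law_X8 mX' l') _.
rewrite ler_piMl ?normal_moment8_ge0// exprn_ile1//.
  by apply: Rintegral_ge0 => w _; exact: sqr_ge0.
have -> : \int[P]_w (h^-1 * X w) ^+ 2 = \int[P]_w (h ^- 2 * X w ^+ 2).
  by apply: eq_Rintegral => w _; rewrite exprMn exprVn.
by rewrite RintegralZl// ler_pdivrMl ?exprn_gt0// mulr1.
Qed.

Variables (Y : Omega -> R) (m s : R) (g : R -> R).
Hypothesis s_ge0 : 0 <= s.
Hypotheses (mY : measurable_fun setT Y) (lY : normal_law P Y m s).
Hypotheses (mg : measurable_fun setT g) (g_ge0 : forall y, 0 <= g y).
Hypothesis ig2 : integrableR P (fun w => g (Y w) ^+ 2).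

Let mgY : measurable_fun setT (fun w => g (Y w)).
Proof. exact: measurableT_comp. Qed.

Let ig : integrableR P (fun w => g (Y w)).
Proof. exact: integrableR_sqr. Qed.

Let iY : integrableR P Y.
Proof. exact: (normal_law_integrableX mY lY (k := 1)). Qed.

Let iY2 : integrableR P (fun w => Y w ^+ 2).
Proof. exact: (normal_law_integrableX mY lY). Qed.

(** If Y has variance 0, the regression coefficient below would divide by zero; but then Y = m
    almost surely and the factorization is exact. *)
Let degenerate : s = 0 -> forall U : Omega -> R, measurable_fun setT U ->
  integrableR P (fun w => U w ^+ 2) ->
  integrableR P (fun w => g (Y w) * U w ^+ 2) /\
  \int[P]_w (g (Y w) * U w ^+ 2) = \int[P]_w g (Y w) * \int[P]_w U w ^+ 2.
Proof.
move=> s0 U mU iU2.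
have Ym : {ae P, forall w, Y w = m}.
  exists (Y @^-1` (~` [set m])); split.
  - by apply: measurable_preimage => //; exact: measurableC.
  - have := lY (measurableC (measurable_set1 m)) => ->.
    rewrite (_ : _ @^-1` _ = set0) ?measure0//.
    by apply/seteqP; split => // z /=; rewrite s0 mul0r addr0.
  - by [].
have igm : integrableR P (fun w => g m * U w ^+ 2) by exact: integrableRZ.
have E : (\int[P]_w (g (Y w) * U w ^+ 2)%:E = \int[P]_w (g m * U w ^+ 2)%:E)%E.
  apply: ae_eq_integral => //.
  - by apply/measurable_EFinP; mfun.
  - by apply/measurable_EFinP; mfun.
  - by apply: filterS Ym => w -> _.
have Eg : \int[P]_w g (Y w) = g m.
  rewrite -[RHS](RintegralE_cst P) /Rintegral; congr fine.
  apply: ae_eq_integral => //.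
  - by apply/measurable_EFinP; mfun.
  - by apply: filterS Ym => w -> _.
split.
  apply/integrableP; split; first by apply/measurable_EFinP; mfun.
  rewrite [ltLHS](_ : _ = \int[P]_w (g (Y w) * U w ^+ 2)%:E)%E.
    by rewrite E integralE_R// ltry.
  by apply: eq_integral => w _ /=; rewrite ger0_norm// mulr_ge0// sqr_ge0.
by rewrite {1}/Rintegral E -/(Rintegral _ _ _) RintegralZl// Eg.
Qed.

Let J w : R := 1 + `|Y w - m|.

Let iJ4 : integrableR P (fun w => J w ^+ 4).
Proof.
have iYm : integrableR P (fun w => (Y w - m) ^+ 4).
  apply: (@normal_law_integrableX _ _ _ P (fun w => Y w - m) (m - m) s _ _ 4) => //.
    by mfun.
  have := normal_law_affine (- m) 1 mY lY; rewrite !mul1r addrC.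
  by apply: normal_law_ext => w; rewrite mul1r addrC.
apply: (integrableR_le _ (integrableRZ 8 (integrableRD (integrableR_cst P 1) iYm))).
  by rewrite /J; mfun.
move=> w; rewrite ger0_norm ?exprn_even_ge0// /J.
rewrite -[(Y w - m) ^+ 4]ger0_norm ?exprn_even_ge0// normrX.
exact: exprn4_1D_le.
Qed.

(** Chosen so that the affine part of U is at most delta kappa J: its mean is at most delta and its
    slope at most delta (1 + |m|) / s^2. *)
Let kappa : R := 1 + (1 + `|m|) / s ^+ 2.
Let M : R := \int[P]_w (g (Y w) ^+ 2 + J w ^+ 4) + 1 + normal_moment8 R.

(** Write U = W + k with k the linear regression of U on Y. In g(Y) U^2 the term g(Y) W^2 factorizes
    exactly; the cross term is of order delta h and the term in k^2 of order delta^2. *)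
Let regular : 0 < s -> forall U : Omega -> R, measurable_fun setT U ->
  jointly_normal Y U -> forall delta h, 0 < h -> 0 <= delta ->
  `|\int[P]_w U w| <= delta -> `|\int[P]_w (U w * Y w)| <= delta ->
  \int[P]_w U w ^+ 2 <= h ^+ 2 ->
  integrableR P (fun w => g (Y w) * U w ^+ 2) /\
  `|\int[P]_w (g (Y w) * U w ^+ 2) - \int[P]_w g (Y w) * \int[P]_w U w ^+ 2|
  <= (2 * kappa * M + kappa ^+ 2 * M + kappa ^+ 2 * M ^+ 2) * (delta * h + delta ^+ 2).
Proof.
move=> s0 U mU jYU delta h h0 delta0 EUd EUYd EU2h.
have [mU' [sU [_ lU]]] := jYU 0 1.
have {}lU : normal_law P U mU' sU.
  by apply: normal_law_ext lU => w; rewrite mul0r add0r mul1r.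
have iU : integrableR P U by exact: (normal_law_integrableX mU lU (k := 1)).
have iU2 : integrableR P (fun w => U w ^+ 2) by exact: (normal_law_integrableX mU lU).
have iUY := integrableRM mU mY iU2 iY2.
have EY : \int[P]_w Y w = m by exact: normal_law_mean lY.
have EY2 : \int[P]_w Y w ^+ 2 = m ^+ 2 + s ^+ 2 by exact: normal_law_sqr lY.
set u := \int[P]_w U w in EUd.
set v := \int[P]_w (U w * Y w) in EUYd.
(* The covariance of U and Y divided by the variance of Y, which makes the residual W uncorrelated
   with Y. *)
pose a := (v - u * m) / s ^+ 2.
have s20 : 0 < s ^+ 2 by rewrite exprn_gt0.
pose k w := u + a * (Y w - m).
pose W w := U w - k w.
have WE w : W w = (a * m - u) + (- a * Y w + 1 * U w) by rewrite /W /k; ring.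
have mk : measurable_fun setT k by rewrite /k; mfun.
have mW : measurable_fun setT W by rewrite /W; mfun.
have [mW' [sW [_ lW]]] := jointly_normal_affine (- a) 1 (a * m - u) mY mU jYU.
have {}lW : normal_law P W mW' sW by apply: normal_law_ext lW => w; rewrite WE.
have iW : integrableR P W by exact: (normal_law_integrableX mW lW (k := 1)).
have iW2 : integrableR P (fun w => W w ^+ 2) by exact: (normal_law_integrableX mW lW).
have ik : integrableR P k.
  by apply: integrableRD (integrableR_cst P u) _; apply: integrableRZ; apply: integrableRB => //; exact: integrableR_cst.
have EW : \int[P]_w W w = 0.
  rewrite RintegralB// /k RintegralD//; last 2 first.
  - exact: integrableR_cst.
  - by apply: integrableRZ; apply: integrableRB => //; exact: integrableR_cst.
  rewrite RintegralE_cst RintegralZl//; last by apply: integrableRB => //; exact: integrableR_cst.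
  rewrite RintegralB//; last exact: integrableR_cst.
  by rewrite RintegralE_cst EY -/u; ring.
have EYW : \int[P]_w (Y w * W w) = 0.
  rewrite (_ : Rintegral _ _ _ = \int[P]_w (U w * Y w + ((a * m - u) * Y w + - a * Y w ^+ 2))).
    rewrite RintegralD//; last by apply: integrableRD; exact: integrableRZ.
    rewrite RintegralD//; last 2 first.
    - exact: integrableRZ.
    - exact: integrableRZ.
    by rewrite !RintegralZl// EY EY2 -/v /a; field; rewrite gt_eqF.
  by apply: eq_Rintegral => w _; rewrite WE; ring.
have iYW := integrableRM mY mW iY2 iW2.
have gaussW (b : R) : exists m' s' : R, 0 <= s' /\ normal_law P (fun w => Y w + b * W w) m' s'.
  have [m1 [s1 [s10 l1]]] := jointly_normal_affine (1 - b * a) b (b * (a * m - u)) mY mU jYU.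
  exists m1, s1; split => //.
  by apply: normal_law_ext l1 => w; rewrite WE; ring.
have [igW2 EgW2] := uncorrelated_sqr mY mW gaussW s0 lY iW2 EW EYW mg g_ge0 ig.
have kappa_ge0 : 0 <= kappa by rewrite addr_ge0// divr_ge0 ?addr_ge0// ltW.
have J1 w : 1 <= J w by rewrite lerDl.
have kJ w : `|k w| <= delta * kappa * J w.
  apply: (@le_trans _ _ (delta + delta * ((1 + `|m|) / s ^+ 2) * `|Y w - m|)).
    rewrite (le_trans (ler_normD _ _))// lerD// normrM ler_wpM2r//.
    rewrite /a normrM normfV (gtr0_norm s20) mulrA ler_wpM2r ?invr_ge0 ?(ltW s20)//.
    rewrite (le_trans (ler_normB _ _))// normrM mulrDr mulr1 lerD//.
    by rewrite ler_wpM2r.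
  rewrite /kappa /J; move: `|Y w - m| (normr_ge0 (Y w - m)) => y y0.
  have : 0 <= (1 + `|m|) / s ^+ 2 by rewrite divr_ge0 ?addr_ge0// ltW.
  move: (_ / _) => q q0.
  have := mulr_ge0 delta0 y0; have := mulr_ge0 delta0 q0; nra.
have k2J w : k w ^+ 2 <= (delta * kappa) ^+ 2 * J w ^+ 2.
  rewrite -exprMn -(real_normK (num_real (k w))) lerXn2r// ?nnegrE//.
  by rewrite mulr_ge0 ?mulr_ge0// (le_trans ler01).
have J2J4 w : J w ^+ 2 <= J w ^+ 4 by rewrite ler_weXn2l.
have iB : integrableR P (fun w => g (Y w) ^+ 2 + J w ^+ 4) by exact: integrableRD.
have dk0 : 0 <= (delta * kappa) ^+ 2 by exact: sqr_ge0.
have gk2 w : `|g (Y w) * k w ^+ 2| <= (delta * kappa) ^+ 2 * (g (Y w) ^+ 2 + J w ^+ 4).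
  rewrite ger0_norm; last by apply: mulr_ge0 => //; exact: sqr_ge0.
  apply: le_trans (ler_wpM2l (g_ge0 _) (k2J w)) _; rewrite mulrCA ler_wpM2l//.
  rewrite (exprM _ 2 2); move: (J w ^+ 2) => j.
  by have := sqr_ge0 (g (Y w) - j); have := sqr_ge0 (g (Y w) + j); nra.
(* Scaled to second moment at most 1, so that its eighth moment is bounded by an absolute
   constant. *)
pose X w := h^-1 * W w.
have mX : measurable_fun setT X by rewrite /X; mfun.
have lX : normal_law P X (0 + h^-1 * mW') (h^-1 * sW).
  by apply: normal_law_ext (normal_law_affine 0 h^-1 mW lW) => w; rewrite add0r.
have iX8 : integrableR P (fun w => X w ^+ 8) by exact: (normal_law_integrableX mX lX).
have iB' : integrableR P (fun w => g (Y w) ^+ 2 + J w ^+ 4 + (1 + X w ^+ 8)).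
  by apply: integrableRD => //; apply: integrableRD => //; exact: integrableR_cst.
have mJ : measurable_fun setT J by rewrite /J; mfun.
have dkh0 : 0 <= delta * kappa * h by rewrite !mulr_ge0// ltW.
have gWk w : `|g (Y w) * W w * k w| <= delta * kappa * h * (g (Y w) ^+ 2 + J w ^+ 4 + (1 + X w ^+ 8)).
  rewrite !normrM (ger0_norm (g_ge0 _)).
  have -> : `|W w| = h * `|X w|.
    by rewrite /X normrM gtr0_norm ?invr_gt0// mulrA divff ?mul1r// gt_eqF.
  apply: (@le_trans _ _ (g (Y w) * (h * `|X w|) * (delta * kappa * J w))).
    by rewrite ler_wpM2l// !mulr_ge0// ltW.
  rewrite [leLHS](_ : _ = delta * kappa * h * (g (Y w) * (`|X w| * J w))); last by ring.
  rewrite ler_wpM2l//.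
  have h1 : g (Y w) * (`|X w| * J w) <= g (Y w) ^+ 2 + (`|X w| * J w) ^+ 2.
    have := sqr_ge0 (g (Y w) - `|X w| * J w).
    by have := sqr_ge0 (g (Y w) + `|X w| * J w); nra.
  have h2 : (`|X w| * J w) ^+ 2 <= J w ^+ 4 + X w ^+ 4.
    rewrite exprMn real_normK ?num_real// !(exprM _ 2 2).
    by have := sqr_ge0 (J w ^+ 2 - X w ^+ 2); have := sqr_ge0 (J w ^+ 2 + X w ^+ 2); nra.
  have := normX_le_1DX8 (X w) (k := 4) isT; rewrite ger0_norm ?exprn_even_ge0//.
  lra.
have mgWk : measurable_fun setT (fun w => g (Y w) * W w * k w) by mfun.
have mgk2 : measurable_fun setT (fun w => g (Y w) * k w ^+ 2) by mfun.
have igWk := integrableR_le mgWk (integrableRZ _ iB') gWk.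
have igk2 := integrableR_le mgk2 (integrableRZ _ iB) gk2.
have ik2 : integrableR P (fun w => k w ^+ 2).
  apply: (integrableR_le _ (integrableRZ ((delta * kappa) ^+ 2) iJ4)); first by mfun.
  move=> w; rewrite ger0_norm ?sqr_ge0// (le_trans (k2J w))//.
  by rewrite ler_wpM2l.
have gUE w : g (Y w) * U w ^+ 2 = g (Y w) * W w ^+ 2 + (2 * (g (Y w) * W w * k w) + g (Y w) * k w ^+ 2).
  by rewrite (_ : U w = W w + k w) /W ?subrK//; ring.
have igr : integrableR P (fun w => 2 * (g (Y w) * W w * k w) + g (Y w) * k w ^+ 2).
  by apply: integrableRD => //; exact: integrableRZ.
have igU : integrableR P (fun w => g (Y w) * U w ^+ 2).
  by apply: eq_integrable (integrableRD igW2 igr) => // w _ /=; rewrite -gUE.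
have iWk := integrableRM mW mk iW2 ik2.
(* Pythagoras: W is orthogonal to 1 and to Y, hence to k. In particular E[W^2] inherits the bound
   h^2. *)
have EU2 : \int[P]_w U w ^+ 2 = \int[P]_w W w ^+ 2 + \int[P]_w k w ^+ 2.
  rewrite (_ : \int[P]_w U w ^+ 2 = \int[P]_w (W w ^+ 2 + (2 * (W w * k w) + k w ^+ 2))).
    rewrite RintegralD//; last by apply: integrableRD => //; exact: integrableRZ.
    rewrite RintegralD//; last exact: integrableRZ.
    rewrite RintegralZl// (_ : \int[P]_w (W w * k w) = 0) ?mulr0 ?add0r//.
    rewrite (_ : Rintegral _ _ _ = \int[P]_w ((u - a * m) * W w + a * (Y w * W w))).
      rewrite RintegralD//; last 2 first.
      - exact: integrableRZ.
      - exact: integrableRZ.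
      by rewrite !RintegralZl// EW EYW !mulr0 addr0.
    by apply: eq_Rintegral => w _; rewrite /k; ring.
  by apply: eq_Rintegral => w _; rewrite (_ : U w = W w + k w) /W ?subrK//; ring.
have Ek20 : 0 <= \int[P]_w k w ^+ 2 by apply: Rintegral_ge0 => w _; exact: sqr_ge0.
have EW2h : \int[P]_w W w ^+ 2 <= h ^+ 2 by move: EU2h; rewrite EU2; lra.
have EX8 := normal_scaled_moment8 mW lW h0 EW2h.
split => //.
rewrite (eq_Rintegral _ (fun w _ => gUE w)).
rewrite RintegralD// EgW2 EU2 RintegralD//; last exact: integrableRZ.
rewrite RintegralZl//.
have B0 : 0 <= \int[P]_w (g (Y w) ^+ 2 + J w ^+ 4).
  by apply: Rintegral_ge0 => w _; rewrite addr_ge0 ?sqr_ge0// exprn_even_ge0.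
have C0 := normal_moment8_ge0 R.
have M1 : 1 <= M by rewrite /M -addrA (addrCA _ 1) lerDl addr_ge0.
have BM : \int[P]_w (g (Y w) ^+ 2 + J w ^+ 4) <= M by rewrite /M -addrA lerDl addr_ge0.
have b1 : `|\int[P]_w (g (Y w) * W w * k w)| <= delta * kappa * h * M.
  apply: le_trans (normr_Rintegral_le mgWk (integrableRZ _ iB') gWk) _.
  rewrite RintegralZl// ler_wpM2l// RintegralD//; last first.
    by apply: integrableRD => //; exact: integrableR_cst.
  rewrite (RintegralD measurableT (integrableR_cst P 1) iX8).
  by rewrite RintegralE_cst addrA lerD2l.
have b2 : `|\int[P]_w (g (Y w) * k w ^+ 2)| <= (delta * kappa) ^+ 2 * M.
  apply: le_trans (normr_Rintegral_le mgk2 (integrableRZ _ iB) gk2) _.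
  by rewrite RintegralZl// ler_wpM2l.
have b3 : \int[P]_w k w ^+ 2 <= (delta * kappa) ^+ 2 * M.
  apply: (@le_trans _ _ (\int[P]_w ((delta * kappa) ^+ 2 * (g (Y w) ^+ 2 + J w ^+ 4)))).
    apply: le_Rintegral => //; first exact: integrableRZ.
    move=> w _; rewrite (le_trans (k2J w))// ler_wpM2l//.
    by rewrite (le_trans (J2J4 w))// lerDr sqr_ge0.
  by rewrite RintegralZl// ler_wpM2l.
have b4 : \int[P]_w g (Y w) <= M.
  apply: (@le_trans _ _ (\int[P]_w (1 + (g (Y w) ^+ 2 + J w ^+ 4)))).
    apply: le_Rintegral => //; first by apply: integrableRD => //; exact: integrableR_cst.
    move=> w _; have : 0 <= J w ^+ 4 by rewrite exprn_even_ge0.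
    by have := sqr_ge0 (g (Y w) - 1); nra.
  rewrite RintegralD//; last exact: integrableR_cst.
  by rewrite RintegralE_cst /M addrC lerDl.
have b5 : 0 <= \int[P]_w g (Y w) by apply: Rintegral_ge0 => w _.
have b6 : \int[P]_w g (Y w) * \int[P]_w k w ^+ 2 <= M * ((delta * kappa) ^+ 2 * M).
  exact: ler_pM.
have b7 := mulr_ge0 b5 Ek20.
rewrite [X in `|X|](_ : _ = 2 * \int[P]_w (g (Y w) * W w * k w) + \int[P]_w (g (Y w) * k w ^+ 2)
   - \int[P]_w g (Y w) * \int[P]_w k w ^+ 2); last by ring.
apply: (@le_trans _ _ (2 * (delta * kappa * h * M) + (delta * kappa) ^+ 2 * M + M * ((delta * kappa) ^+ 2 * M))).
  move: b1 b2; rewrite !ler_norml => /andP[? ?] /andP[? ?].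
  by apply/andP; split; lra.
(* These are the surplus terms that the common factor delta h + delta^2 adds to the bound just
   obtained. *)
have h1 : 0 <= 2 * kappa * M * delta ^+ 2.
  by rewrite !mulr_ge0 ?sqr_ge0// (le_trans ler01).
have h2 : 0 <= (kappa ^+ 2 * M + kappa ^+ 2 * M ^+ 2) * (delta * h).
  by rewrite mulr_ge0 ?addr_ge0 ?mulr_ge0 ?sqr_ge0 ?(ltW h0)// (le_trans ler01).
rewrite -subr_ge0 [leRHS](_ : _ = 2 * kappa * M * delta ^+ 2 +
  (kappa ^+ 2 * M + kappa ^+ 2 * M ^+ 2) * (delta * h)); last by ring.
exact: addr_ge0.
Qed.

Lemma quadratic_estimate : exists2 K, 0 <= K &
  forall U : Omega -> R, measurable_fun setT U ->
  jointly_normal Y U -> forall delta h, 0 < h -> 0 <= delta ->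
  `|\int[P]_w U w| <= delta -> `|\int[P]_w (U w * Y w)| <= delta ->
  \int[P]_w U w ^+ 2 <= h ^+ 2 ->
  integrableR P (fun w => g (Y w) * U w ^+ 2) /\
  `|\int[P]_w (g (Y w) * U w ^+ 2) - \int[P]_w g (Y w) * \int[P]_w U w ^+ 2|
  <= K * (delta * h + delta ^+ 2).
Proof.
move: s_ge0; rewrite le_eqVlt => /predU1P[s0|s0].
  exists 0 => // U mU jYU delta h _ _ _ _ _.
  have [mU' [sU [_ lU]]] := jYU 0 1.
  have {}lU : normal_law P U mU' sU.
    by apply: normal_law_ext lU => w; rewrite mul0r add0r mul1r.
  have iU2 : integrableR P (fun w => U w ^+ 2) by exact: (normal_law_integrableX mU lU).
  have [? ->] := degenerate (esym s0) mU iU2.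
  by rewrite subrr normr0 mul0r.
exists (2 * kappa * M + kappa ^+ 2 * M + kappa ^+ 2 * M ^+ 2); last exact: regular.
have k0 : 0 <= kappa by rewrite addr_ge0// divr_ge0 ?addr_ge0// sqr_ge0.
have M0 : 0 <= M.
  rewrite addr_ge0 ?normal_moment8_ge0// addr_ge0//.
  by apply: Rintegral_ge0 => w _; rewrite addr_ge0 ?sqr_ge0// exprn_even_ge0.
by rewrite !addr_ge0 ?mulr_ge0 ?sqr_ge0.
Qed.

End quadratic_estimate.

(** * Taylor expansion and products of increments *)

(** The mean value theorem is applied to f and then to f'. The usual factor 1/2 is lost, but c stays
    between a and b, which is what the passage to a time on the path requires. *)
Lemma class_C2_taylor (R : realType) (f : R -> R) (a b : R) : class_C2 f ->
  exists2 c, Num.min a b <= c <= Num.max a b &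
  `|f b - f a - derive1 f a * (b - a)| <= `|derive1n 2 f c| * (b - a) ^+ 2.
Proof.
move=> [df ddf _].
have fd x : is_derive x (1 : R) f (derive1 f x).
  by apply: DeriveDef => //; rewrite derive1E.
have fdd x : is_derive x (1 : R) (derive1 f) (derive1 (derive1 f) x).
  by apply: DeriveDef; [exact: ddf|rewrite derive1E].
rewrite -[derive1n 2 f]/(derive1 (derive1 f)).
have cf : continuous f by move=> x; apply/differentiable_continuous/derivable1_diffP.
have cdf : continuous (derive1 f).
  by move=> x; apply/differentiable_continuous/derivable1_diffP.
have mvt u v : u <= v -> exists2 c, u <= c <= v & f v - f u = derive1 f c * (v - u).
  move=> uv; have [|c cuv E] := @MVT_segment _ f (derive1 f) u v uv.
    exact: continuous_subspaceT.
  by exists c.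
have mvt' u v : u <= v -> exists2 c, u <= c <= v &
    derive1 f v - derive1 f u = derive1 (derive1 f) c * (v - u).
  move=> uv; have [|c cuv E] := @MVT_segment _ (derive1 f) (derive1 (derive1 f)) u v uv.
    exact: continuous_subspaceT.
  by exists c.
have key c d : f b - f a = derive1 f c * (b - a) ->
    derive1 f c - derive1 f a = derive1 (derive1 f) d * (c - a) ->
    `|c - a| <= `|b - a| ->
    `|f b - f a - derive1 f a * (b - a)| <= `|derive1 (derive1 f) d| * (b - a) ^+ 2.
  move=> -> E cb; rewrite -mulrBl E -mulrA normrM ler_wpM2l// normrM.
  by rewrite -(real_normK (num_real (b - a))) expr2 ler_wpM2r.
have [ab|ba] := leP a b.
  have [c /andP[ac cb] E1] := mvt a b ab.
  have [d /andP[ad dc] E2] := mvt' a c ac.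
  exists d; first by rewrite ad (le_trans dc).
  by apply: key E1 E2 _; rewrite !ger0_norm ?subr_ge0// lerB.
have [c /andP[bc ca] E1] := mvt b a (ltW ba).
have [d /andP[cd da] E2] := mvt' c a ca.
exists d; first by rewrite da (le_trans bc).
apply: (key c d).
- by rewrite -opprB E1; ring.
- by rewrite -opprB E2; ring.
- by rewrite !ler0_norm ?subr_le0// ?(ltW ba)// !opprB lerB.
Qed.

(** Inversion is not continuous at 0, where its value is 0 by convention, so the singleton {0} is
    split off. *)
Lemma measurable_inv (R : realType) : measurable_fun setT (@GRing.inv R).
Proof.
have m0 : measurable ([set 0] : set R) by exact: measurable_set1.
rewrite -(setvU [set 0]); apply/measurable_funU => //; first exact: measurableC.
split.
  apply: open_continuous_measurable_fun; first by apply: closed_openC; exact: closed_eq.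
  by move=> x; rewrite inE => /eqP x0; exact: inv_continuous.
exact: measurable_fun_set1.
Qed.

(* Stated for g possibly nonmeasurable: in the moment hypothesis on f'' the
   supremum ranges over uncountably many times. *)
Lemma ge0_le_integralT d (T : measurableType d) (R : realType)
    (mu : {measure set T -> \bar R}) (f g : T -> \bar R) :
  (forall x, 0 <= f x)%E -> (forall x, f x <= g x)%E ->
  (\int[mu]_x f x <= \int[mu]_x g x)%E.
Proof.
move=> f0 fg; have g0 x : (0 <= g x)%E by exact: le_trans (fg x).
rewrite !ge0_integralTE//; apply: ereal_sup_le => _ [h hf <-].
by exists h => // x; exact: le_trans (fg x).
Qed.

(** With the increments written as h a and h b, two terms carry h^3 and the last h^4, which h <= 1
    reduces to h^3. Young's inequality applied twice separates the remaining factors. *)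
Lemma cross_terms_le (R : realFieldType) (F q1 q2 a b h : R) : 0 < h -> h <= 1 ->
  `|F * (h * a) * (q2 * (h * b) ^+ 2) + F * (h * b) * (q1 * (h * a) ^+ 2) +
    q1 * (h * a) ^+ 2 * (q2 * (h * b) ^+ 2)| <=
  h ^+ 3 * (2 * F ^+ 4 + ((2 * q1 ^+ 4 + 2 * q2 ^+ 4) +
    (2 + (3 * a ^+ 8 + 3 * b ^+ 8)))).
Proof.
move=> h0 h1.
have sqM_le (x y : R) : (x * y) ^+ 2 <= x ^+ 4 + y ^+ 4.
  by rewrite exprMn (le_trans (ler_norm _))// (le_trans (normM_le_sqrD _ _))// -!exprM.
have t (q x y : R) : `|F * q * (x * y ^+ 2)| <=
    F ^+ 4 + q ^+ 4 + (1 + x ^+ 8 + y ^+ 8).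
  apply: le_trans (normM_le_sqrD _ _) _; apply: lerD; first exact: sqM_le.
  rewrite (le_trans (sqM_le _ _))// -exprM lerD2r.
  by rewrite (le_trans (ler_norm _))// normX_le_1DX8.
have t3 : `|q1 * q2 * (a ^+ 2 * b ^+ 2)| <= q1 ^+ 4 + q2 ^+ 4 + (a ^+ 8 + b ^+ 8).
  apply: le_trans (normM_le_sqrD _ _) _; apply: lerD; first exact: sqM_le.
  by rewrite (le_trans (sqM_le _ _))// -!exprM.
have t1 := t q2 a b; have t2 := t q1 b a.
rewrite [X in `|X|](_ : _ = h ^+ 3 * ((F * q2 * (a * b ^+ 2)) +
  (F * q1 * (b * a ^+ 2)) + h * (q1 * q2 * (a ^+ 2 * b ^+ 2)))); last by ring.
rewrite normrM gtr0_norm ?exprn_gt0// ler_wpM2l ?exprn_ge0 ?(ltW h0)//.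
have t3' : `|h * (q1 * q2 * (a ^+ 2 * b ^+ 2))| <= q1 ^+ 4 + q2 ^+ 4 + (a ^+ 8 + b ^+ 8).
  by rewrite normrM gtr0_norm// (le_trans _ t3)// ler_piMl.
rewrite (le_trans (ler_normD _ _))// (le_trans (lerD (ler_normD _ _) (lexx _)))//.
rewrite (le_trans (lerD (lerD t1 t2) t3'))//; lra.
Qed.

(** * Products of two Taylor-expanded increments *)

Section product_estimate.
Context d (Omega : measurableType d) (R : realType) (P : probability Omega R).
Variables (Y : Omega -> R) (m s : R) (F : R -> R).
Hypotheses (s_ge0 : 0 <= s) (mY : measurable_fun setT Y) (lY : normal_law P Y m s).
Hypothesis mF : measurable_fun setT F.
Hypothesis iF4 : integrableR P (fun w => F (Y w) ^+ 4).

Let mFY : measurable_fun setT (fun w => F (Y w)).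
Proof. exact: measurableT_comp. Qed.

(** Polarization reduces F(Y)^2 X1 X2 to the squares of X1 + X2 and X1 - X2; the terms with a
    remainder Q contribute the h^3. The constant depends on Y, F and S only, hence is uniform over
    the increments. *)
Lemma product_estimate (S : R) : exists2 K, 0 <= K &
  forall (X1 X2 Q1 Q2 : Omega -> R) (h delta : R),
  measurable_fun setT X1 -> measurable_fun setT X2 ->
  measurable_fun setT Q1 -> measurable_fun setT Q2 ->
  (forall a b c : R, exists m s,
    0 <= s /\ normal_law P (fun w => a * Y w + b * X1 w + c * X2 w) m s) ->
  integrableR P (fun w => Q1 w ^+ 4) -> integrableR P (fun w => Q2 w ^+ 4) ->
  \int[P]_w Q1 w ^+ 4 <= S -> \int[P]_w Q2 w ^+ 4 <= S ->
  0 < h -> h <= 1 -> 0 <= delta ->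
  `|\int[P]_w X1 w| <= delta -> `|\int[P]_w X2 w| <= delta ->
  `|\int[P]_w (X1 w * Y w)| <= delta -> `|\int[P]_w (X2 w * Y w)| <= delta ->
  \int[P]_w X1 w ^+ 2 <= h ^+ 2 -> \int[P]_w X2 w ^+ 2 <= h ^+ 2 ->
  let V1 w := F (Y w) * X1 w + Q1 w * X1 w ^+ 2 in
  let V2 w := F (Y w) * X2 w + Q2 w * X2 w ^+ 2 in
  integrableR P (fun w => V1 w * V2 w) /\
  `|\int[P]_w (V1 w * V2 w) -
    \int[P]_w (F (Y w) ^+ 2) * \int[P]_w (X1 w * X2 w)|
  <= K * (delta * h + delta ^+ 2 + h ^+ 3).
Proof.
have igF : integrableR P (fun w => ((fun y => F y ^+ 2) (Y w)) ^+ 2).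
  by apply: eq_integrable iF4 => // w _ /=; rewrite -exprM.
have mF2 : measurable_fun setT (fun y => F y ^+ 2) by mfun.
have F2_ge0 y : 0 <= F y ^+ 2 by exact: sqr_ge0.
have [K0 K00 HK] := quadratic_estimate s_ge0 mY lY mF2 F2_ge0 igF.
pose C8 := normal_moment8 R.
(* The expectation of the bound in [cross_terms_le], with S and C8 in place of the moments; the
   absolute value of S makes it visibly nonnegative. *)
pose K1 := 2 * \int[P]_w F (Y w) ^+ 4 + 4 * `|S| + 2 + 6 * C8.
have C80 : 0 <= C8 by exact: normal_moment8_ge0.
have K10 : 0 <= K1.
  have : 0 <= \int[P]_w F (Y w) ^+ 4.
    by apply: Rintegral_ge0 => w _; rewrite exprn_even_ge0.
  by have := normr_ge0 S; rewrite /K1; lra.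
exists (2 * K0 + K1); first by rewrite addr_ge0// mulr_ge0.
move=> X1 X2 Q1 Q2 h delta mX1 mX2 mQ1 mQ2 gauss iQ1 iQ2 Q1S Q2S h0 h1 delta0.
move=> EX1 EX2 EX1Y EX2Y X1h X2h V1 V2.
have [m1 [s1 [_ l1]]] := gauss 0 1 0.
have {}l1 : normal_law P X1 m1 s1 by apply: normal_law_ext l1 => w; ring.
have [m2 [s2 [_ l2]]] := gauss 0 0 1.
have {}l2 : normal_law P X2 m2 s2 by apply: normal_law_ext l2 => w; ring.
have iX1 : integrableR P X1 by exact: (normal_law_integrableX mX1 l1 (k := 1)).
have iX2 : integrableR P X2 by exact: (normal_law_integrableX mX2 l2 (k := 1)).
have iX12 : integrableR P (fun w => X1 w ^+ 2) by exact: (normal_law_integrableX mX1 l1).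
have iX22 : integrableR P (fun w => X2 w ^+ 2) by exact: (normal_law_integrableX mX2 l2).
have iY2 : integrableR P (fun w => Y w ^+ 2) by exact: (normal_law_integrableX mY lY).
have iXX := integrableRM mX1 mX2 iX12 iX22.
have iX1Y := integrableRM mX1 mY iX12 iY2.
have iX2Y := integrableRM mX2 mY iX22 iY2.
have quad (e : R) : `|e| = 1 ->
    integrableR P (fun w => F (Y w) ^+ 2 * (X1 w + e * X2 w) ^+ 2) /\
    `|\int[P]_w (F (Y w) ^+ 2 * (X1 w + e * X2 w) ^+ 2) -
      \int[P]_w (F (Y w) ^+ 2) * \int[P]_w (X1 w + e * X2 w) ^+ 2|
    <= K0 * (4 * (delta * h + delta ^+ 2)).
  move=> e1; have e2 : e ^+ 2 = 1 by rewrite -(real_normK (num_real e)) e1 expr1n.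
  (* The sum and the difference satisfy the hypotheses of [quadratic_estimate] with 2 delta and 2
     h. *)
  rewrite (_ : 4 * (delta * h + delta ^+ 2) = (2 * delta) * (2 * h) + (2 * delta) ^+ 2); last by ring.
  apply: (HK (fun w => X1 w + e * X2 w)).
  - by mfun.
  - move=> a b; have [m' [s' [s'0 l']]] := gauss a b (b * e).
    by exists m', s'; split => //; apply: normal_law_ext l' => w; ring.
  - by rewrite mulr_gt0.
  - by rewrite mulr_ge0.
  - rewrite RintegralD// ?RintegralZl//; last exact: integrableRZ.
    by rewrite (le_trans (ler_normD _ _))// normrM e1 mul1r; lra.
  - rewrite (_ : Rintegral _ _ _ = \int[P]_w (X1 w * Y w + e * (X2 w * Y w))).
      rewrite RintegralD// ?RintegralZl//; last exact: integrableRZ.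
      by rewrite (le_trans (ler_normD _ _))// normrM e1 mul1r; lra.
    by apply: eq_Rintegral => w _; ring.
  - apply: (@le_trans _ _ (\int[P]_w (2 * X1 w ^+ 2 + 2 * X2 w ^+ 2))).
      apply: le_Rintegral => //.
      + apply: (integrableR_le _ (integrableRD (integrableRZ 2 iX12) (integrableRZ 2 iX22))).
          by mfun.
        move=> w; rewrite ger0_norm ?sqr_ge0//.
        have := sqr_ge0 (X1 w - e * X2 w); rewrite !sqrrD !exprMn sqrrN exprMn e2; nra.
      + by apply: integrableRD; exact: integrableRZ.
      + move=> w _; have := sqr_ge0 (X1 w - e * X2 w).
        by rewrite !sqrrD sqrrN !exprMn e2; nra.
    rewrite RintegralD//; last 2 first.
    + exact: integrableRZ.
    + exact: integrableRZ.
    by rewrite !RintegralZl//; nra.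
have [iqp qp] := quad 1 (normr1 _).
have [iqm qm] := quad (-1) ltac:(by rewrite normrN normr1).
have iXp (e : R) : integrableR P (fun w => (X1 w + e * X2 w) ^+ 2).
  apply: eq_integrable (integrableRD iX12 (integrableRD (integrableRZ (2 * e) iXX) (integrableRZ (e ^+ 2) iX22))) => // w _ /=.
  by congr EFin; ring.
have EXX : \int[P]_w (X1 w * X2 w) = 4^-1 *
    (\int[P]_w (X1 w + 1 * X2 w) ^+ 2 - \int[P]_w (X1 w + -1 * X2 w) ^+ 2).
  rewrite -RintegralB// -RintegralZl//; last exact: integrableRB.
  by apply: eq_Rintegral => w _; field.
have iFXX : integrableR P (fun w => F (Y w) ^+ 2 * (X1 w * X2 w)).
  apply: eq_integrable (integrableRZ 4^-1 (integrableRB iqp iqm)) => // w _ /=.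
  by congr EFin; field.
have EFXX : \int[P]_w (F (Y w) ^+ 2 * (X1 w * X2 w)) = 4^-1 *
    (\int[P]_w (F (Y w) ^+ 2 * (X1 w + 1 * X2 w) ^+ 2) -
     \int[P]_w (F (Y w) ^+ 2 * (X1 w + -1 * X2 w) ^+ 2)).
  rewrite -RintegralB// -RintegralZl//; last exact: integrableRB.
  by apply: eq_Rintegral => w _; field.
have main : `|\int[P]_w (F (Y w) ^+ 2 * (X1 w * X2 w)) -
    \int[P]_w (F (Y w) ^+ 2) * \int[P]_w (X1 w * X2 w)| <= 2 * K0 * (delta * h + delta ^+ 2).
  rewrite EFXX EXX; move: qp qm; rewrite !ler_norml => /andP[? ?] /andP[? ?].
  by apply/andP; split; lra.
pose A w := h^-1 * X1 w; pose B w := h^-1 * X2 w.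
have X1E w : X1 w = h * A w by rewrite /A mulrA divff ?mul1r// gt_eqF.
have X2E w : X2 w = h * B w by rewrite /B mulrA divff ?mul1r// gt_eqF.
have mA : measurable_fun setT A by rewrite /A; mfun.
have mB : measurable_fun setT B by rewrite /B; mfun.
have iA8 : integrableR P (fun w => A w ^+ 8).
  by exact: (normal_law_integrableX mA (normal_law_ext (fun w => add0r _) (normal_law_affine 0 h^-1 mX1 l1))).
have iB8 : integrableR P (fun w => B w ^+ 8).
  by exact: (normal_law_integrableX mB (normal_law_ext (fun w => add0r _) (normal_law_affine 0 h^-1 mX2 l2))).
have EA8 : \int[P]_w A w ^+ 8 <= C8 := normal_scaled_moment8 mX1 l1 h0 X1h.
have EB8 : \int[P]_w B w ^+ 8 <= C8 := normal_scaled_moment8 mX2 l2 h0 X2h.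
pose rest w := F (Y w) * X1 w * (Q2 w * X2 w ^+ 2) +
  F (Y w) * X2 w * (Q1 w * X1 w ^+ 2) + Q1 w * X1 w ^+ 2 * (Q2 w * X2 w ^+ 2).
pose D w := 2 * F (Y w) ^+ 4 + ((2 * Q1 w ^+ 4 + 2 * Q2 w ^+ 4) + (2 + (3 * A w ^+ 8 + 3 * B w ^+ 8))).
have mrest : measurable_fun setT rest by rewrite /rest; mfun.
have iQ12 : integrableR P (fun w => 2 * Q1 w ^+ 4 + 2 * Q2 w ^+ 4).
  by apply: integrableRD; exact: integrableRZ.
have iAB : integrableR P (fun w => 3 * A w ^+ 8 + 3 * B w ^+ 8).
  by apply: integrableRD; exact: integrableRZ.
have i2AB : integrableR P (fun w => 2 + (3 * A w ^+ 8 + 3 * B w ^+ 8)).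
  by apply: integrableRD => //; exact: integrableR_cst.
have iQAB := integrableRD iQ12 i2AB.
have iD : integrableR P D by apply: integrableRD => //; exact: integrableRZ.
have rest_le w : `|rest w| <= h ^+ 3 * D w.
  by rewrite /rest /D X1E X2E; exact: cross_terms_le.
have Erest : `|\int[P]_w rest w| <= h ^+ 3 * K1.
  apply: le_trans (normr_Rintegral_le mrest (integrableRZ _ iD) rest_le) _.
  rewrite RintegralZl// ler_wpM2l ?exprn_ge0 ?(ltW h0)//.
  rewrite /D (RintegralD measurableT (integrableRZ _ iF4) iQAB).
  rewrite (RintegralD measurableT iQ12 i2AB).
  rewrite (RintegralD measurableT (integrableR_cst P 2) iAB).
  rewrite (RintegralD measurableT (integrableRZ _ iQ1) (integrableRZ _ iQ2)).
  rewrite (RintegralD measurableT (integrableRZ _ iA8) (integrableRZ _ iB8)).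
  rewrite !RintegralZl// RintegralE_cst /K1.
  by have := ler_norm S; lra.
have VE w : V1 w * V2 w = F (Y w) ^+ 2 * (X1 w * X2 w) + rest w.
  by rewrite /V1 /V2 /rest; ring.
have irest := integrableR_le mrest (integrableRZ _ iD) rest_le.
split; first by apply: eq_integrable (integrableRD iFXX irest) => // w _ /=; rewrite -VE.
rewrite (eq_Rintegral _ (fun w _ => VE w)) RintegralD//.
rewrite addrAC (le_trans (ler_normD _ _))// (le_trans (lerD main Erest))//.
have e1 : 0 <= K1 * (delta * h + delta ^+ 2).
  by rewrite mulr_ge0// addr_ge0 ?sqr_ge0// mulr_ge0// ltW.
have e2 : 0 <= 2 * K0 * h ^+ 3 by apply: mulr_ge0; [rewrite mulr_ge0|rewrite exprn_ge0// ltW].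
by nra.
Qed.

End product_estimate.

(** * Neighbourhoods of the origin and small powers *)

Lemma near_nbhs_origin (R : realType) (A : set (R * R)) (e : R) : 0 < e ->
  (forall r s, `|r| < e -> `|s| < e -> A (r, s)) -> nbhs ((0, 0) : R * R) A.
Proof.
move=> e0 H; apply/nbhs_ballP; exists e => // -[r s] [/= h1 h2].
by apply: H; [move: h1|move: h2]; rewrite /ball/= sub0r normrN.
Qed.

Lemma dnbhs_origin_near (R : realType) (A : set (R * R)) :
  ((0, 0) : R * R)^' A -> exists2 e : R, 0 < e &
  forall r s, (r, s) != (0, 0) -> `|r| < e -> `|s| < e -> A (r, s).
Proof.
move=> /nbhs_ballP[e /= e0 H]; exists e => // r s rs0 re se; apply: H => //.
by split => /=; rewrite /ball/= sub0r normrN.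
Qed.

Lemma nbhs0_near (R : realType) (A : set R) : nbhs (0 : R) A ->
  exists2 e : R, 0 < e & forall r, `|r| < e -> A r.
Proof.
move=> /nbhs_ballP[e /= e0 H]; exists e => // r re; apply: H.
by rewrite /ball/= sub0r normrN.
Qed.

Lemma powR_small (R : realType) (k e : R) : 0 < k -> 0 < e ->
  exists2 eta, 0 < eta & forall q, 0 <= q -> q <= eta -> q `^ k <= e.
Proof.
move=> k0 e0; exists (e `^ k^-1); first exact: powR_gt0.
move=> q q0 qe; apply: (@le_trans _ _ ((e `^ k^-1) `^ k)).
  by apply: ge0_ler_powR => //; [exact: ltW|rewrite nnegrE powR_ge0].
by rewrite -powRrM mulVf ?gt_eqF// powRr1// ltW.
Qed.

Lemma expectation_bigO_near (R : realType) (g : R -> \bar R) : expectation_bigO g ->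
  exists2 A : R, 0 <= A & exists2 e : R, 0 < e &
    forall r, `|r| < e -> g r \is a fin_num /\ `|fine (g r)| <= A * `|r|.
Proof.
move=> [rho /eqO_exP[A A0 rhoA] grho]; exists A; first exact: ltW.
have [e e0 He] := nbhs0_near rhoA; have [e' e'0 He'] := nbhs0_near grho.
exists (Num.min e e'); first by rewrite lt_min e0.
move=> r; rewrite lt_min => /andP[re re'].
by have -> := He' r re'; split => //=; have := He r re; rewrite /= normr_id.
Qed.

(** * Consequences of the uniform scaling condition *)

Section scaling.
Context d (Omega : measurableType d) (R : realType) (P : probability Omega R).
Context (X : R -> Omega -> R) (T gamma : R) (L : R -> R) (C : R -> R -> R).
Hypothesis X_scaling : uniform_scaling P X T gamma L C.

Lemma uniform_scaling_near tau e : tau \in `]0, T[ -> 0 < e ->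
  exists2 eta : R, 0 < eta & forall r s, (r, s) != (0, 0) ->
    `|r| < eta -> `|s| < eta -> 0 <= tau + r -> 0 <= tau + s ->
    increment_moment P X tau r s \is a fin_num ->
    `|fine (increment_moment P X tau r s) - L tau * C r s| <=
      e * (r ^+ 2 + s ^+ 2) `^ (gamma / 2).
Proof.
move=> tauT e0; have [_ _ _ lim _] := X_scaling.
have /lim/dnbhs_origin_near[eta eta0 H] : nbhs (0%E : \bar R) [set y | (y < e%:E)%E].
  exact: (@nbhs_open_ereal_lt _ 0 (fun=> e)).
exists eta => // r s rs0 re se tr ts ifin.
have {}H := H r s rs0 re se.
have q0 : 0 < r ^+ 2 + s ^+ 2.
  rewrite lt_neqAle eq_sym addr_ge0 ?sqr_ge0// andbT.
  rewrite paddr_eq0 ?sqr_ge0// !sqrf_eq0; apply: contra rs0.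
  by move=> /andP[/eqP -> /eqP ->].
have : ((((r ^+ 2 + s ^+ 2) `^ (- (gamma / 2)))%:E *
    `| increment_moment P X tau r s - (L tau * C r s)%:E |) <= e%:E)%E.
  apply: le_trans (ltW H); apply: ereal_sup_ubound; by exists tau.
rewrite -(fineK ifin) -EFinB abse_EFin -EFinM lee_fin powRN.
by rewrite ler_pdivrMl ?powR_gt0// [leRHS]mulrC.
Qed.

(** The limit in the scaling condition excludes the origin, whereas the expansion to be proved
    includes it. Homogeneity with h = 2 gives C(0, 0) = 2^gamma C(0, 0). *)
Lemma uniform_scaling_origin : gamma != 0 -> C 0 0 = 0.
Proof.
move=> g0; have [_ _ hom _ _] := X_scaling.
have := hom 0 0 2 ltac:(by []); rewrite mulr0 => /eqP.
rewrite -subr_eq0 -[X in X - _]mul1r -mulrBl mulf_eq0 => /orP[|/eqP//].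
rewrite subr_eq0 eq_sym powR_eq1 (negbTE g0) orbF => /orP[/eqP h|]; lra.
Qed.

(** E[X_r^2] involves C on the diagonal only, where homogeneity with h = |r| reduces it to the value
    at (1, 1) or (-1, -1) according to the sign of r. *)
Lemma uniform_scaling_diagonal r : r != 0 -> 
  `|C r r| <= (r ^+ 2) `^ (gamma / 2) * (`|C 1 1| + `|C (-1) (-1)|).
Proof.
move=> r0; have [_ _ hom _ _] := X_scaling.
have rp : 0 < `|r| by rewrite normr_gt0.
have -> : (r ^+ 2) `^ (gamma / 2) = `|r| `^ gamma.
  rewrite -(real_normK (num_real r)) -powR_mulrn// -powRrM; congr (_ `^ _).
  by field.
have hC e : r = `|r| * e -> `|C r r| = `|r| `^ gamma * `|C e e|.
  by move=> E; rewrite [in LHS]E hom// normrM (ger0_norm (powR_ge0 _ _)).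
have [r1|r1] := ltP 0 r.
  by rewrite (hC 1) ?ler_wpM2l ?powR_ge0 ?lerDl// gtr0_norm ?mulr1.
by rewrite (hC (-1)) ?ler_wpM2l ?powR_ge0 ?lerDr// ler0_norm// mulrN1 opprK.
Qed.

End scaling.

(** * Taylor remainder along the paths *)

Section process.
Context d (Omega : measurableType d) (R : realType) (P : probability Omega R).
Variables (Z : R -> {RV P >-> R}) (T : R) (f : R -> R).
Hypothesis Z_continuous : forall w : Omega,
  {within `[0, T], continuous (fun t : R => Z t w)}.
Hypothesis f_C2 : class_C2 f.

Lemma continuous_class_C2 : continuous f /\ continuous (derive1 f).
Proof.
have [df ddf _] := f_C2.
by split => x; apply/differentiable_continuous/derivable1_diffP.
Qed.

(** Taylor's formula yields an intermediate value of the path; by continuity it is attained at a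
    time between tau and tau + r. Thus f'' is evaluated at some Z_t, as the moment hypothesis
    requires. *)
Lemma path_remainder (tau r eps : R) (w : Omega) : 0 <= tau <= T ->
  0 <= tau + r <= T -> `|r| < eps ->
  exists2 t, tau - eps < t < tau + eps /\ 0 <= t &
  `|f (Z (tau + r) w) - f (Z tau w) -
    derive1 f (Z tau w) * (Z (tau + r) w - Z tau w)| <=
  `|derive1n 2 f (Z t w)| * (Z (tau + r) w - Z tau w) ^+ 2.
Proof.
move=> /andP[t0 tT] /andP[tr0 trT] re.
have [c cZ H] := class_C2_taylor (Z tau w) (Z (tau + r) w) f_C2.
suff [t /andP[t1 t2] Zt] : exists2 t, Num.min tau (tau + r) <= t <= Num.max tau (tau + r) & Z t w = c.
  exists t; last by rewrite Zt.
  move: re; rewrite ltr_norml => /andP[re1 re2].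
  have h1 : Num.min tau (tau + r) > tau - eps by rewrite lt_min; apply/andP; split; lra.
  have h2 : Num.max tau (tau + r) < tau + eps by rewrite gt_max; apply/andP; split; lra.
  split; first by rewrite (lt_le_trans h1 t1) (le_lt_trans t2 h2).
  by apply: le_trans t1; rewrite le_min t0.
have ivt a b : 0 <= a -> a <= b -> b <= T ->
    Num.min (Z a w) (Z b w) <= c <= Num.max (Z a w) (Z b w) ->
    exists2 t, a <= t <= b & Z t w = c.
  move=> a0 ab bT cab.
  have [||t tab Zt] := @IVT _ (fun t => Z t w) a b c ab.
  - apply: (continuous_subspaceW _ (@Z_continuous w)) => x /=; rewrite !in_itv/=.
    by move=> /andP[ax xb]; rewrite (le_trans a0 ax) (le_trans xb bT).
  - exact: cab.
  - by exists t.
have [r0|r0] := leP 0 r.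
  by rewrite min_l ?max_r ?lerDl//; apply: ivt; rewrite ?lerDl.
have r0' := ltW r0.
by rewrite min_r ?max_l ?gerDl//; apply: ivt; rewrite ?gerDl// minC maxC.
Qed.

(** Q is defined as remainder over squared increment, not as f'' at an intermediate point: the
    quotient is evidently measurable, while the intermediate time depends on w through a mere
    existence statement. *)
Lemma path_remainder_quotient (tau eps : R) : tau \in `]0, T[ -> 0 < eps ->
  (\int[P]_w ereal_sup [set (derive1n 2 f (Z t w) ^+ 4)%:E
     | t in [set t : R | (tau - eps < t < tau + eps)%R /\ (0 <= t)%R]] < +oo)%E ->
  exists S : R, exists2 eta : R, 0 < eta & forall r, `|r| < eta ->
  [/\ 0 <= tau + r, tau + r <= T & exists Q : Omega -> R,
    [/\ measurable_fun setT Q, integrableR P (fun w => Q w ^+ 4),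
      \int[P]_w Q w ^+ 4 <= S &
      forall w, f (Z (tau + r) w) - f (Z tau w) =
        derive1 f (Z tau w) * (Z (tau + r) w - Z tau w) +
        Q w * (Z (tau + r) w - Z tau w) ^+ 2]].
Proof.
rewrite in_itv/= => /andP[tau0 tauT] eps0.
set sup := (X in (\int[P]_w X w < _)%E); move=> supoo.
exists (fine (\int[P]_w sup w)), (Num.min eps (Num.min tau (T - tau))).
  by rewrite !lt_min eps0 tau0 subr_gt0.
move=> r; rewrite !lt_min => /and3P[reps rtau rT].
have tr0 : 0 <= tau + r by move: rtau; rewrite ltr_norml; lra.
have trT : tau + r <= T by move: rT; rewrite ltr_norml; lra.
split => //.
have [cf cdf] := continuous_class_C2.
pose X w := Z (tau + r) w - Z tau w.
pose V w := f (Z (tau + r) w) - f (Z tau w) - derive1 f (Z tau w) * X w.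
pose Q w := V w * (X w ^+ 2)^-1.
have mf : measurable_fun setT f by exact: continuous_measurable_fun.
have mdf : measurable_fun setT (derive1 f) by exact: continuous_measurable_fun.
have mZ t : measurable_fun setT (Z t) by exact: measurable_funP.
have mX : measurable_fun setT X by rewrite /X; mfun.
have mQ : measurable_fun setT Q.
  apply: measurable_funM.
    apply: measurable_funB; last by apply: measurable_funM => //; exact: measurableT_comp.
    by apply: measurable_funB; exact: measurableT_comp.
  by apply: measurableT_comp; [exact: measurable_inv|mfun].
have rem w : exists2 t, tau - eps < t < tau + eps /\ 0 <= t &
    `|V w| <= `|derive1n 2 f (Z t w)| * X w ^+ 2.
  by apply: path_remainder => //; apply/andP; split => //; exact: ltW.
have Qsup w : ((Q w ^+ 4)%:E <= sup w)%E.
  have [t ht Vt] := rem w.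
  apply: (@le_trans _ _ (derive1n 2 f (Z t w) ^+ 4)%:E); last first.
    by apply: ereal_sup_ubound; exists t.
  rewrite lee_fin -[Q w ^+ 4]ger0_norm ?exprn_even_ge0// normrX.
  rewrite -[leRHS]ger0_norm ?exprn_even_ge0// normrX lerXn2r ?nnegrE//.
  rewrite /Q normrM; have [->|X0] := eqVneq (X w) 0.
    by rewrite expr0n invr0 normr0 mulr0.
  have X20 : 0 < X w ^+ 2 by rewrite exprn_even_gt0.
  by rewrite normfV (gtr0_norm X20) ler_pdivrMr.
have Q4 : (\int[P]_w (Q w ^+ 4)%:E <= \int[P]_w sup w)%E.
  by apply: ge0_le_integralT => // w; rewrite lee_fin exprn_even_ge0.
have Q40 : (0 <= \int[P]_w (Q w ^+ 4)%:E)%E.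
  by apply: integral_ge0 => w _; rewrite lee_fin exprn_even_ge0.
exists Q; split => //.
- apply/integrableP; split; first by apply/measurable_EFinP; mfun.
  rewrite [ltLHS](_ : _ = \int[P]_w (Q w ^+ 4)%:E)%E.
    exact: le_lt_trans supoo.
  by apply: eq_integral => w _ /=; rewrite ger0_norm// exprn_even_ge0.
- apply: fine_le => //.
  + by rewrite ge0_fin_numE// (le_lt_trans Q4).
  + by rewrite ge0_fin_numE// (le_trans Q40).
(* Where the increment vanishes, Q is 0 by the convention on inverses, and the remainder is 0 by its
   bound. *)
- move=> w; rewrite -/(X w) /Q; have [X0|X0] := eqVneq (X w) 0.
    have [t _] := rem w; rewrite X0 expr0n mulr0 normr_le0 => /eqP.
    by rewrite /V X0 mulr0 subr0 => ->; rewrite !mulr0 addr0.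
  by rewrite divfK ?expf_neq0// /V; ring.
Qed.

End process.

(** * The scaling condition for f(Z) *)

Unset Implicit Arguments.
Set Strict Implicit.
Set Printing Implicit Defensive.

Theorem proposition2p6 (d : measure_display) (Omega : measurableType d)
  (R : realType) (P : probability Omega R) (Z : R -> {RV P >-> R})
  (T gamma : R) (L : R -> R) (C : R -> R -> R) (f : R -> R)
  (T_gt0 : 0 < T) (gamma_ge1 : 1 <= gamma) (gamma_lt2 : gamma < 2)
  (Z_gaussian : gaussian_process Z)
  (Z_scaling : uniform_scaling P Z T gamma L C)
  (Z_continuous : forall w : Omega,
     {within `[0, T], continuous (fun t : R => Z t w)})
  (f_C2 : class_C2 f)
  (Z_incr_cov : forall tau : R, tau \in `]0, T[ ->
     expectation_bigO (fun r : R =>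
       'E_P[fun w => ((Z (tau + r) w - Z tau w) * Z tau w)%R])%E)
  (Z_incr_mean : forall tau : R, tau \in `]0, T[ ->
     expectation_bigO (fun r : R => 'E_P[Z (tau + r)%R] - 'E_P[Z tau])%E)
  (f'_moment : forall tau : R, tau \in `]0, T[ ->
     ('E_P[fun w => (derive1 f (Z tau w) ^+ 4)%R] < +oo)%E)
  (f''_moment : forall tau : R, tau \in `]0, T[ ->
     exists2 eps : R, 0 < eps &
       (\int[P]_w ereal_sup [set (derive1n 2 f (Z t w) ^+ 4)%:E
          | t in [set t : R | tau - eps < t < tau + eps /\ 0 <= t]%R] < +oo)%E) :
  forall tau : R, tau \in `]0, T[ ->
    scaling_at P (fun t w => f (Z t w)) tau gamma
      ('E_P[fun w => (derive1 f (Z tau w) ^+ 2)%R] * (L tau)%:E)%E C.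
Proof.
move=> tau tauT.
have /andP[tau0 tauT'] : 0 < tau < T by move: tauT; rewrite in_itv.
have mZ t : measurable_fun setT (Z t) by exact: measurable_funP.
pose X r w := Z (tau + r) w - Z tau w.
have mX r : measurable_fun setT (X r) by rewrite /X; mfun.
have gauss r s : 0 <= tau + r -> 0 <= tau + s -> forall a b c : R, exists m' s',
    0 <= s' /\ normal_law P (fun w => a * Z tau w + b * X r w + c * X s w) m' s'.
  move=> tr ts a b c.
  (* The coefficient a - b - c at tau compensates for the two increments, each of which subtracts
     Z_tau. *)
  have /gaussian_rv_normal_law[m' [s' [s'0 l']]] :=
    Z_gaussian 3 (fun i => nth 0 [:: a - b - c; b; c] i)
      (fun i => nth 0 [:: tau; tau + r; tau + s] i)
      ltac:(by case=> [[|[|[|//]]] ?] //=; exact: ltW).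
  exists m', s'; split => //; apply: normal_law_ext l' => w.
  by rewrite !big_ord_recl big_ord0/= /X; ring.
have [mY [sY [sY0 lY]]] : exists m' s', 0 <= s' /\ normal_law P (Z tau) m' s'.
  have [|| m' [s' [s'0 l']]] := gauss 0 0 _ _ 1 0 0; rewrite ?addr0 ?ltW//.
  by exists m', s'; split => //; apply: normal_law_ext l' => w; ring.
have lX r : 0 <= tau + r -> exists m' s', normal_law P (X r) m' s'.
  move=> tr; have [m' [s' [_ l']]] := gauss r r tr tr 0 1 0.
  by exists m', s'; apply: normal_law_ext l' => w; ring.
have iX r : 0 <= tau + r -> integrableR P (X r).
  by move=> /lX[m' [s' l']]; exact: (normal_law_integrableX (mX r) l' (k := 1)).
have iX2 r : 0 <= tau + r -> integrableR P (fun w => X r w ^+ 2).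
  by move=> /lX[m' [s' l']]; exact: (normal_law_integrableX (mX r) l').
have iXX r s : 0 <= tau + r -> 0 <= tau + s -> integrableR P (fun w => X r w * X s w).
  by move=> tr ts; exact: integrableRM (mX r) (mX s) (iX2 _ tr) (iX2 _ ts).
have iY : integrableR P (Z tau).
  by exact: (normal_law_integrableX (mZ tau) lY (k := 1)).
have incE r s : 0 <= tau + r -> 0 <= tau + s ->
    increment_moment P Z tau r s = (\int[P]_w (X r w * X s w))%:E.
  by move=> tr ts; rewrite /increment_moment unlock -integralE_R//; exact: iXX.
have [df ddf _] := f_C2.
have [cf cdf] := continuous_class_C2 f_C2.
have mdf : measurable_fun setT (derive1 f) by exact: continuous_measurable_fun.
have mdfY : measurable_fun setT (fun w => derive1 f (Z tau w)) by exact: measurableT_comp.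
have iF4 : integrableR P (fun w => derive1 f (Z tau w) ^+ 4).
  apply/integrableP; split; first by apply/measurable_EFinP; mfun.
  rewrite [ltLHS](_ : _ = 'E_P[fun w => (derive1 f (Z tau w) ^+ 4)%R])%E.
    exact: f'_moment.
  by rewrite unlock; apply: eq_integral => w _ /=; rewrite ger0_norm// exprn_even_ge0.
have iF2 : integrableR P (fun w => derive1 f (Z tau w) ^+ 2).
  apply: (integrableR_le _ (integrableRD (integrableR_cst P 1) iF4)); first by mfun.
  move=> w; rewrite (exprM _ 2 2) ger0_norm ?sqr_ge0//.
  by have := sqr_ge0 (derive1 f (Z tau w) ^+ 2 - 1); have := sqr_ge0 (derive1 f (Z tau w)); nra.
pose G := \int[P]_w (derive1 f (Z tau w) ^+ 2).
have G0 : 0 <= G by apply: Rintegral_ge0 => w _; exact: sqr_ge0.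
have GE : 'E_P[fun w => (derive1 f (Z tau w) ^+ 2)%R]%E = G%:E.
  by rewrite unlock -integralE_R.
have [eps eps0 supoo] := f''_moment tau tauT.
have [S [eta0 eta00 HQ]] := path_remainder_quotient Z_continuous f_C2 tauT eps0 supoo.
have [A1 A10 [eta1 eta10 HA1]] := expectation_bigO_near (Z_incr_cov tau tauT).
have [A2 A20 [eta2 eta20 HA2]] := expectation_bigO_near (Z_incr_mean tau tauT).
have [K K0 HK] := product_estimate sY0 (mZ tau) lY mdf iF4 S.
have [eta3 eta30 H3] := uniform_scaling_near Z_scaling tauT (@ltr01 R).
pose g2 := gamma / 2.
(* The last two summands come from E[X_r^2] <= L C(r, r) + (2 r^2)^g2, the scaling condition with
   error 1. The summand 1 ensures B <= B^2, so that the second moments fit under h^2 with h = B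
   q^(gamma/4). *)
pose B := 1 + `|L tau| * (`|C 1 1| + `|C (-1) (-1)|) + 2 `^ g2.
pose A := A1 + A2.
have A0 : 0 <= A by rewrite addr_ge0.
have B1 : 1 <= B.
  by rewrite /B -addrA lerDl addr_ge0 ?powR_ge0// mulr_ge0 ?addr_ge0.
have B0 : 0 < B by exact: lt_le_trans B1.
have g20 : 0 <= g2 by rewrite /g2; lra.
have secondmoment r s : `|r| < eta0 -> `|r| < eta3 ->
    \int[P]_w X r w ^+ 2 <= B ^+ 2 * (r ^+ 2 + s ^+ 2) `^ g2.
  move=> re0 re3; have [tr _ _] := HQ r re0.
  (* At r = 0 the scaling condition, applied on the diagonal, says nothing. *)
  have [r0|r0] := eqVneq r 0.
    have -> : \int[P]_w X r w ^+ 2 = 0.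
      rewrite -[RHS](RintegralE_cst P); apply: eq_Rintegral => w _.
      by rewrite /X r0 addr0 subrr expr0n.
    by rewrite mulr_ge0 ?powR_ge0 ?sqr_ge0.
  have r20 : 0 <= r ^+ 2 by exact: sqr_ge0.
  apply: (@le_trans _ _ (B * (r ^+ 2) `^ g2)); last first.
    apply: ler_pM; rewrite ?powR_ge0 ?(ltW B0)//; first by rewrite expr2 ler_peMr// ltW.
    by apply: ge0_ler_powR; rewrite ?nnegrE ?addr_ge0 ?sqr_ge0// lerDl sqr_ge0.
  have := H3 r r _ re3 re3 tr tr; rewrite incE//= => /(_ _ isT).
  rewrite xpair_eqE negb_and r0 => /(_ isT).
  have -> : \int[P]_w (X r w * X r w) = \int[P]_w X r w ^+ 2.
    by apply: eq_Rintegral.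
  rewrite mul1r (_ : r ^+ 2 + r ^+ 2 = 2 * r ^+ 2); last by ring.
  rewrite powRM// -/g2 => h.
  have h1 := uniform_scaling_diagonal Z_scaling r0; rewrite -/g2 in h1.
  have h2 : `|L tau * C r r| <= `|L tau| * ((r ^+ 2) `^ g2 * (`|C 1 1| + `|C (-1) (-1)|)).
    by rewrite normrM ler_wpM2l.
  have h3 := powR_ge0 (r ^+ 2) g2.
  move: h h2; rewrite !ler_norml => /andP[_ h] /andP[_ h2].
  by rewrite /B; lra.
have C00 : C 0 0 = 0 by apply: (uniform_scaling_origin Z_scaling); rewrite gt_eqF// (lt_le_trans ltr01).
pose V r w := f (Z (tau + r) w) - f (Z tau w).
pose inc r s := increment_moment P (fun t w => f (Z t w)) tau r s.
pose rho (rs : R * R) := fine (inc rs.1 rs.2) - G * L tau * C rs.1 rs.2.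
(* The gain in the exponent: 1/2 + gamma/4 = gamma/2 + k, and k > 0 amounts to gamma < 2. *)
pose k := 1 / 2 - gamma / 4.
have k0 : 0 < k by rewrite /k; lra.
pose Kt := K * (A * B + A ^+ 2 + B ^+ 3).
have Kt0 : 0 <= Kt by rewrite mulr_ge0// !addr_ge0 ?mulr_ge0 ?exprn_ge0 ?(ltW B0).
have estimate (e : R) : 0 < e -> exists2 eta : R, 0 < eta & forall r s,
    (r, s) != (0, 0) -> `|r| < eta -> `|s| < eta ->
    inc r s \is a fin_num /\ `|rho (r, s)| <= e * (r ^+ 2 + s ^+ 2) `^ g2.
  (* Each of the two errors receives half of [e]: G times the scaling error of Z here, and Kt q^k
     below. Adding 1 to G and to Kt avoids dividing by zero. *)
  move=> e0; pose e1 := e / (2 * (G + 1)).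
  have e10 : 0 < e1 by rewrite divr_gt0// mulr_gt0// ltr_wpDl.
  have [eta4 eta40 H4] := uniform_scaling_near Z_scaling tauT e10.
  (* The first bound on q^k forces h <= 1, the second makes the product error at most half of
     [e]. *)
  pose e2 := Num.min B^-1 (e / (2 * (Kt + 1))).
  have e20 : 0 < e2 by rewrite lt_min invr_gt0 B0 divr_gt0// mulr_gt0// ltr_wpDl.
  have [eta5 eta50 H5] := powR_small k0 e20.
  (* The last two radii give q <= |r| + |s| <= min(1, eta5). *)
  exists (Num.min (Num.min eta0 eta1) (Num.min (Num.min eta2 eta3)
    (Num.min eta4 (Num.min (1 / 2) (eta5 / 2))))).
    by rewrite !lt_min eta00 eta10 eta20 eta30 eta40 !divr_gt0.
  move=> r s rs0.
  rewrite !lt_min => /andP[/andP[r_0 r_1] /andP[/andP[r_2 r_3] /and3P[r_4 r_5 r_6]]].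
  move=> /andP[/andP[s_0 s_1] /andP[/andP[s_2 s_3] /and3P[s_4 s_5 s_6]]].
  set q := r ^+ 2 + s ^+ 2.
  have q0 : 0 < q.
    rewrite lt_neqAle eq_sym addr_ge0 ?sqr_ge0// andbT.
    rewrite paddr_eq0 ?sqr_ge0// !sqrf_eq0; apply: contra rs0.
    by move=> /andP[/eqP -> /eqP ->].
  have q_le : q <= `|r| + `|s|.
    have r1 : `|r| <= 1 by move: r_5; clear; lra.
    have s1 : `|s| <= 1 by move: s_5; clear; lra.
    rewrite /q -(real_normK (num_real r)) -(real_normK (num_real s)).
    by apply: lerD; rewrite expr2 ler_piMl.
  have q1 : q <= 1 by move: q_le r_5 s_5; clear; lra.
  have q5 : q <= eta5 by move: q_le r_6 s_6; clear; lra.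
  have [tr trT [Q1 [mQ1 iQ1 Q1S V1E]]] := HQ r r_0.
  have [ts tsT [Q2 [mQ2 iQ2 Q2S V2E]]] := HQ s s_0.
  have qk : q `^ k <= e2 by apply: H5 => //; exact: ltW.
  have q01 : 0 < q <= 1 by rewrite q0 q1.
  pose h := B * q `^ (gamma / 4); pose delta := A * q `^ (1 / 2).
  have h0 : 0 < h by rewrite mulr_gt0// powR_gt0.
  (* As q <= 1, this says gamma/4 >= k, that is gamma >= 1. *)
  have qg4 : q `^ (gamma / 4) <= q `^ k by apply: ger_powR => //; rewrite /k; lra.
  have h1 : h <= 1.
    rewrite /h mulrC -ler_pdivlMr// div1r (le_trans qg4)// (le_trans qk)//.
    by rewrite /e2 ge_min lexx.
  have delta0 : 0 <= delta by rewrite mulr_ge0// powR_ge0.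
  have sqrtq (x : R) : x ^+ 2 <= q -> `|x| <= q `^ (1 / 2).
    move=> xq; rewrite div1r powR12_sqrt ?(ltW q0)// -sqrtr_sqr.
    by rewrite ler_wsqrtr.
  have rq : r ^+ 2 <= q by rewrite lerDl sqr_ge0.
  have sq : s ^+ 2 <= q by rewrite lerDr sqr_ge0.
  have EX x : 0 <= tau + x -> x ^+ 2 <= q -> `|x| < eta2 -> `|\int[P]_w X x w| <= delta.
    move=> tx xq x2; have [_] := HA2 x x2; rewrite unlock.
    have iZx : integrableR P (Z (tau + x)).
      apply: eq_integrable (integrableRD (iX x tx) iY) => // w _ /=.
      by rewrite /X subrK.
    rewrite !integralE_R// -EFinB /= -RintegralB// => /le_trans; apply.
    by apply: ler_pM => //; [rewrite lerDr|exact: sqrtq].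
  have EXY x : x ^+ 2 <= q -> `|x| < eta1 -> `|\int[P]_w (X x w * Z tau w)| <= delta.
    move=> xq x1; have [_] := HA1 x x1; rewrite unlock => /le_trans; apply.
    by apply: ler_pM => //; [rewrite lerDl|exact: sqrtq].
  have h2E : h ^+ 2 = B ^+ 2 * q `^ g2.
    rewrite /h exprMn -(powR_mulrn 2 (powR_ge0 q (gamma / 4))) -powRrM; congr (_ * _ `^ _).
    by rewrite /g2; field.
  have Xr2 : \int[P]_w X r w ^+ 2 <= h ^+ 2 by rewrite h2E; exact: secondmoment.
  have Xs2 : \int[P]_w X s w ^+ 2 <= h ^+ 2.
    by rewrite h2E /q addrC; exact: secondmoment.
  pose W1 w := derive1 f (Z tau w) * X r w + Q1 w * X r w ^+ 2.
  pose W2 w := derive1 f (Z tau w) * X s w + Q2 w * X s w ^+ 2.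
  have [iW HW] : integrableR P (fun w => W1 w * W2 w) /\
      `|\int[P]_w (W1 w * W2 w) - G * \int[P]_w (X r w * X s w)|
      <= K * (delta * h + delta ^+ 2 + h ^+ 3) :=
    HK (X r) (X s) Q1 Q2 h delta (mX r) (mX s) mQ1 mQ2 (gauss r s tr ts)
    iQ1 iQ2 Q1S Q2S h0 h1 delta0 (EX r tr rq r_2) (EX s ts sq s_2)
    (EXY r rq r_1) (EXY s sq s_1) Xr2 Xs2.
  have incVE : inc r s = (\int[P]_w (W1 w * W2 w))%:E.
    rewrite /inc /increment_moment unlock -integralE_R//.
    by apply: eq_integral => w _; rewrite V1E V2E.
  split; first by rewrite incVE.
  rewrite /rho/= incVE /=.
  have := H4 r s rs0 r_4 s_4 tr ts; rewrite incE//= => /(_ isT); rewrite -/q -/g2 => HC.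
  have qg20 : 0 <= q `^ g2 by exact: powR_ge0.
  have qD (a b : R) : q `^ a * q `^ b = q `^ (a + b).
    by rewrite powRD// (gt_eqF q0) implybT.
  (* The three errors are brought to the common power g2 + k of q: the first has it exactly, the
     second has exponent 1, which is larger since gamma < 2, and the third is covered by [qg4]. *)
  have p1 : delta * h = A * B * (q `^ g2 * q `^ k).
    rewrite qD.
    rewrite /delta /h mulrACA qD.
    by congr (_ * _ `^ _); rewrite /g2 /k; field.
  have p2 : delta ^+ 2 <= A ^+ 2 * (q `^ g2 * q `^ k).
    rewrite qD.
    rewrite /delta exprMn -(powR_mulrn 2 (powR_ge0 q (1 / 2))) -powRrM ler_wpM2l ?sqr_ge0//.
    by apply: ger_powR => //; rewrite /g2 /k; lra.
  have p3 : h ^+ 3 <= B ^+ 3 * (q `^ g2 * q `^ k).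
    rewrite /h exprMn ler_wpM2l ?exprn_ge0 ?(ltW B0)// exprSr ler_pM ?exprn_ge0 ?powR_ge0//.
    rewrite -(powR_mulrn 2 (powR_ge0 q (gamma / 4))) -powRrM.
    by rewrite le_eqVlt; apply/orP; left; apply/eqP; congr (_ `^ _); rewrite /g2; field.
  have HW' : K * (delta * h + delta ^+ 2 + h ^+ 3) <= Kt * (q `^ g2 * q `^ k).
    by rewrite /Kt -mulrA; apply: ler_wpM2l => //; rewrite p1; move: p2 p3; clear; lra.
  have b1 : Kt * (q `^ g2 * q `^ k) <= e / 2 * q `^ g2.
    rewrite mulrCA mulrC ler_wpM2r//.
    apply: (@le_trans _ _ (Kt * (e / (2 * (Kt + 1))))).
      by rewrite ler_wpM2l// (le_trans qk)// /e2 ge_min lexx orbT.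
    rewrite mulrA ler_pdivrMr ?mulr_gt0 ?ltr_wpDl//.
    by have := ltW e0; nra.
  have b2 : G * (e1 * q `^ g2) <= e / 2 * q `^ g2.
    rewrite mulrA ler_wpM2r// /e1 mulrA ler_pdivrMr ?mulr_gt0 ?ltr_wpDl//.
    by have := ltW e0; nra.
  (* Insert G E[X_r X_s]: the first difference is the product error, the second the scaling error of
     Z. *)
  rewrite (_ : _ - _ = (\int[P]_w (W1 w * W2 w) - G * \int[P]_w (X r w * X s w)) +
    G * (\int[P]_w (X r w * X s w) - L tau * C r s)); last by ring.
  rewrite (le_trans (ler_normD _ _))//.
  rewrite normrM (ger0_norm G0).
  have := ler_wpM2l G0 HC.
  by move: HW; rewrite -/G; lra.
(* The little-o is taken over full neighbourhoods of (0, 0), so the origin itself must be checked;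
   both increments vanish there. *)
have origin : inc 0 0 = 0%E.
  rewrite /inc /increment_moment unlock integral0_eq// => w _.
  by rewrite addr0 subrr mul0r.
exists rho.
  apply/eqoP => e e0; have [eta eta_gt0 H] := estimate e e0.
  apply: (near_nbhs_origin eta_gt0) => r s re se /=.
  rewrite (ger0_norm (powR_ge0 _ _)).
  have [[-> ->]|rs0] := eqVneq (r, s) (0, 0).
    by rewrite /rho/= origin C00 mulr0 subr0 normr0 mulr_ge0 ?powR_ge0 ?ltW.
  by have [] := H r s rs0 re se.
have [eta eta_gt0 H] := estimate 1 ltr01.
apply: (near_nbhs_origin eta_gt0) => r s re se /=.
rewrite GE -!EFinM -EFinD /rho/= (addrC (G * _ * _)) subrK fineK//.
have [[-> ->]|rs0] := eqVneq (r, s) (0, 0); first by rewrite origin.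
by have [] := H r s rs0 re se.
Qed.
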